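(* Let $V$ be an $n$-dimensional real vector space, $n>4$, with a Lorentz metric $g$ of signature $(-+\dots+)$, and let $T=T^a{}_b$ be a real tensor that is symmetric with respect to $g$. Then $T$ is the superenergy tensor of a 2-form of rank at most four if and only if (a) $T$ satisfies the dominant energy condition, and (b) $\displaystyle\Bigl(T^2-\frac14[T^2]+\frac{1}{4(n-4)}[T]^2\Bigr)\Bigl(T-\frac{1}{n-4}[T]\Bigr)=0$. Further, if $(n-4)^2[T^2]<n[T]^2$ then the 2-form is the sum of two simple spacelike 2-forms, and if $(n-4)^2[T^2]>n[T]^2$ then the 2-form is the sum of one simple spacelike 2-form and one simple 2-form containing a timelike direction.
   Context: Indices are raised and lowered with $g$. $T$ symmetric with respect to $g$ means $g_{ac}T^c{}_b=g_{bc}T^c{}_a$. Index-free notation: products denote composition of $(1,1)$-tensors, $[X]=X^c{}_c$ is the trace, and scalar terms are multiplied by the identity $\delta^a_b$. $T$ is the superenergy tensor of a 2-form $F_{ab}$ if $T^a{}_b=F^{ac}F_{bc}-\frac14F^{cd}F_{cd}\delta^a_b$. The rank of a 2-form $F$ is the dimension of the span of $\{F_{ab}u^b\}$ as $u$ varies. The dominant energy condition means $T_{ab}u^av^b\geq0$ (with $T_{ab}=g_{ac}T^c{}_b$) for every pair of future-pointing causal vectors $u,v$. A simple 2-form is $u_{[a}v_{b]}$ for vectors $u,v$; it is spacelike if the plane spanned by $u,v$ contains only spacelike nonzero vectors, and it contains a timelike direction if this plane contains a timelike vector. *)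

(* Defs.v *)
From HB Require Import structures.
From mathcomp Require Import all_boot all_order all_algebra.
From mathcomp Require Import reals.
Set Implicit Arguments. Unset Strict Implicit. Unset Printing Implicit Defensive.
Import Order.TTheory GRing.Theory Num.Theory.
Local Open Scope ring_scope.

(* V = column vectors 'cV[R]_n; the metric g is the matrix (g_ab);
   a (1,1)-tensor T^a_b is the matrix with T i j = T^i_j, so composition
   of (1,1)-tensors is matrix product and [X] = \tr X. *)

Definition bil (R : comRingType) (n : nat) (g : 'M[R]_n) (u v : 'cV[R]_n) : R :=
  (u^T *m g *m v) 0 0.

Definition lorentz_metric (R : realFieldType) (n : nat) (g : 'M[R]_n) : Prop :=
  g^T = g /\
  exists2 P : 'M[R]_n, P \in unitmx &
    P^T *m g *m P = diag_mx (\row_(i < n) (if (i : nat) == 0%N then -1 else 1)).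

Definition g_symmetric (R : comRingType) (n : nat) (g T : 'M[R]_n) : Prop :=
  (g *m T)^T = g *m T.

(* a 2-form F_ab (lower indices) *)
Definition two_form (R : comRingType) (n : nat) (F : 'M[R]_n) : Prop :=
  F^T = - F.

(* T^a_b = F^{ac} F_{bc} - 1/4 F^{cd} F_{cd} delta^a_b,
   with F^{ab} = g^{ac} g^{bd} F_cd (g^{ab} = inverse of g_ab). *)
Definition superenergy (R : fieldType) (n : nat) (g F : 'M[R]_n) : 'M[R]_n :=
  let Fup := invmx g *m F *m invmx g in
  Fup *m F^T - (4^-1 * \tr (Fup *m F^T))%:M.

Definition causal (R : realFieldType) (n : nat) (g : 'M[R]_n) (u : 'cV[R]_n) : Prop :=
  u != 0 /\ bil g u u <= 0.

(* the time orientation is given by a timelike vector t0: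
   u is future-pointing iff it is causal and g(t0,u) < 0 *)
Definition future_causal (R : realFieldType) (n : nat) (g : 'M[R]_n) (t0 u : 'cV[R]_n) : Prop :=
  causal g u /\ bil g t0 u < 0.

Definition dominant_energy (R : realFieldType) (n : nat) (g : 'M[R]_n) (t0 : 'cV[R]_n)
  (T : 'M[R]_n) : Prop :=
  forall u v : 'cV[R]_n, future_causal g t0 u -> future_causal g t0 v ->
    0 <= bil g u (T *m v).

(* the simple 2-form u_[a v_b] = 1/2 (u_a v_b - u_b v_a), u_a = g_ab u^b *)
Definition simple2 (R : fieldType) (n : nat) (g : 'M[R]_n) (u v : 'cV[R]_n) : 'M[R]_n :=
  2^-1 *: ((g *m u) *m (g *m v)^T - (g *m v) *m (g *m u)^T).

Definition spacelike_plane (R : realFieldType) (n : nat) (g : 'M[R]_n) (u v : 'cV[R]_n) : Prop :=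
  forall a b : R, a *: u + b *: v != 0 -> 0 < bil g (a *: u + b *: v) (a *: u + b *: v).

Definition timelike_plane (R : realFieldType) (n : nat) (g : 'M[R]_n) (u v : 'cV[R]_n) : Prop :=
  exists a b : R, bil g (a *: u + b *: v) (a *: u + b *: v) < 0.

Definition condition_b (R : fieldType) (n : nat) (T : 'M[R]_n) : Prop :=
  let k : R := (n - 4)%:R in
  (T *m T - (4^-1 * \tr (T *m T))%:M + ((4 * k)^-1 * \tr T ^+ 2)%:M)
    *m (T - (k^-1 * \tr T)%:M) = 0.

(* Main.v *)
(* Write A = F^a_b = g^-1 F, so that T = (1/4) tr(A^2) - A^2, and put mu = [T]/(n-4) and
   c = [T^2]/4 - [T]^2/(4(n-4)); condition (b) reads (T^2 - c)(T - mu) = 0.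

   If F has rank at most four, then F is a sum of two wedges x1^y1 + x2^y2, and A^2 satisfies a
   quadratic equation on the image of F (Cayley-Hamilton for a product of 4x4 antisymmetric and
   symmetric matrices) whose constant term q is the Gram determinant of x1, y1, x2, y2.  This
   gives (b), and since (n-4)^2 [T^2] = n [T]^2 - 4 (n-4)^2 q, the sign of q decides whether the
   image of F is spacelike or contains a timelike vector t; in the latter case F = t^y + u^v with
   u and v orthogonal to t.  For (a), in an orthonormal frame adapted to a timelike vector, T(u,v)
   is controlled by a Cauchy-Schwarz inequality between the electric and magnetic parts of F.

   Conversely T - mu should be -A^2.  The dominant energy condition enters through two
   consequences: T(u,u) >= 0 and g(Tu,Tu) <= 0 for causal u.  Comparing c with mu^2 tells on which
   generalized eigenspace of T the metric is Lorentzian and excludes all other algebraic types;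
   the traces force the eigenspaces complementary to that of mu to have total dimension four (or
   two, in the degenerate case c = mu^2), and F is assembled from orthonormal bases of them,
   together with a null rotation if T is not diagonalizable. *)
Require Import Defs.
From HB Require Import structures.
From mathcomp Require Import all_boot all_order all_algebra.
From mathcomp Require Import boolp reals ring lra.
Import Order.TTheory GRing.Theory Num.Theory.
Local Open Scope ring_scope.
Set Implicit Arguments.
Unset Strict Implicit.
Unset Printing Implicit Defensive.

(** * Bilinear forms and matrices *)

Section Bilinear.
Variables (R : comRingType) (n : nat) (g : 'M[R]_n).
Implicit Types (u v w : 'cV[R]_n) (X Y : 'M[R]_n) (a : R).

Definition outer u v : 'M[R]_n := u *m v^T *m g.

Lemma bilDl u v w : bil g (u + v) w = bil g u w + bil g v w.
Proof. by rewrite /bil linearD !mulmxDl mxE. Qed.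

Lemma bilDr u v w : bil g u (v + w) = bil g u v + bil g u w.
Proof. by rewrite /bil mulmxDr mxE. Qed.

Lemma bilZl a u v : bil g (a *: u) v = a * bil g u v.
Proof. by rewrite /bil linearZ -!scalemxAl mxE. Qed.

Lemma bilZr a u v : bil g u (a *: v) = a * bil g u v.
Proof. by rewrite /bil -scalemxAr mxE. Qed.

Lemma bilNl u v : bil g (- u) v = - bil g u v.
Proof. by rewrite -scaleN1r bilZl mulN1r. Qed.

Lemma bilNr u v : bil g u (- v) = - bil g u v.
Proof. by rewrite -scaleN1r bilZr mulN1r. Qed.

Lemma bil0l v : bil g 0 v = 0.
Proof. by rewrite -(scale0r v) bilZl mul0r. Qed.

Lemma bil0r v : bil g v 0 = 0.
Proof. by rewrite -(scale0r v) bilZr mul0r. Qed.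

Definition bilE := (bilDl, bilDr, bilNl, bilNr, bilZl, bilZr, bil0l, bil0r).

Lemma bil_mx u v : u^T *m g *m v = (bil g u v)%:M.
Proof. exact: mx11_scalar. Qed.

Lemma outer_vec u v w : outer u v *m w = bil g v w *: u.
Proof. by rewrite /outer -(mulmxA u) -mulmxA bil_mx mul_mx_scalar. Qed.

Lemma mul_outer X u v : X *m outer u v = outer (X *m u) v.
Proof. by rewrite /outer !mulmxA. Qed.

Lemma outer_mul u v w (z : 'cV[R]_n) : outer u v *m outer w z = bil g v w *: outer u z.
Proof. by rewrite mul_outer outer_vec /outer -!scalemxAl. Qed.

Lemma tr_outer u v : \tr (outer u v) = bil g v u.
Proof. by rewrite /outer -mulmxA mxtrace_mulC bil_mx mxtrace_scalar. Qed.

Lemma outerZl a u v : outer (a *: u) v = a *: outer u v.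
Proof. by rewrite /outer -!scalemxAl. Qed.

Lemma outerZr a u v : outer u (a *: v) = a *: outer u v.
Proof. by rewrite /outer linearZ -scalemxAr -!scalemxAl. Qed.

Lemma outer0l v : outer 0 v = 0.
Proof. by rewrite /outer !mul0mx. Qed.

Hypothesis gs : g^T = g.

Lemma bilC u v : bil g u v = bil g v u.
Proof.
by rewrite /bil -[LHS](mxE trmx_key (fun i j => (u^T *m g *m v) j i)) -/(trmx _)
  !trmx_mul trmxK gs mulmxA.
Qed.

Lemma outer_sym u : g_symmetric g (outer u u).
Proof. by rewrite /g_symmetric /outer !trmx_mul trmxK gs !mulmxA. Qed.

Lemma g_symD X Y : g_symmetric g X -> g_symmetric g Y -> g_symmetric g (X + Y).
Proof. by rewrite /g_symmetric mulmxDr linearD /= => -> ->. Qed.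

Lemma g_symZ a X : g_symmetric g X -> g_symmetric g (a *: X).
Proof. by rewrite /g_symmetric -scalemxAr linearZ /= => ->. Qed.

Lemma g_symN X : g_symmetric g X -> g_symmetric g (- X).
Proof. by rewrite /g_symmetric mulmxN linearN /= => ->. Qed.

Lemma g_sym_scalar a : g_symmetric g a%:M.
Proof. by rewrite /g_symmetric mul_mx_scalar linearZ /= gs. Qed.

Lemma g_sym_tr X : g_symmetric g X -> X^T *m g = g *m X.
Proof. by rewrite /g_symmetric trmx_mul gs. Qed.

Lemma g_symM X Y : g_symmetric g X -> g_symmetric g Y -> X *m Y = Y *m X ->
  g_symmetric g (X *m Y).
Proof.
move=> sX sY XY; rewrite /g_symmetric !trmx_mul gs -mulmxA (g_sym_tr sX).
by rewrite (mulmxA Y^T) (g_sym_tr sY) -mulmxA XY.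
Qed.

Lemma bil_sym X u v : g_symmetric g X -> bil g u (X *m v) = bil g (X *m u) v.
Proof. by move=> sX; rewrite /bil trmx_mul -(mulmxA u^T X^T) g_sym_tr // !mulmxA. Qed.

Lemma outer_mulr X u v : g_symmetric g X -> outer u v *m X = outer u (X *m v).
Proof. by move=> sX; rewrite /outer trmx_mul -!mulmxA g_sym_tr. Qed.

End Bilinear.

Section Matrices.
Variable R : numFieldType.

Lemma nonzero_entry (m n : nat) (M : 'M[R]_(m, n)) : M != 0 -> exists i j, M i j != 0.
Proof.
move=> M0; case: (pickP (fun ij => M ij.1 ij.2 != 0)) => [[i j] h|h]; first by exists i, j.
case/eqP: M0; apply/matrixP => i j; rewrite mxE.
by have /negbFE/eqP := h (i, j).
Qed.

Lemma nonzero_vec (m n : nat) (M : 'M[R]_(m, n)) : M != 0 -> exists y : 'cV_n, M *m y != 0.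
Proof.
move=> /nonzero_entry[i [j Mij]]; exists (delta_mx j 0); apply: contra_neq Mij.
by rewrite -colE => /matrixP/(_ i 0); rewrite !mxE.
Qed.

Lemma matrix_vec_ext (m n : nat) (M N : 'M[R]_(m, n)) :
  (forall y : 'cV_n, M *m y = N *m y) -> M = N.
Proof.
move=> h; apply/matrixP => i j; have := congr1 (fun u : 'cV_m => u i 0) (h (delta_mx j 0)).
by rewrite -!colE !mxE.
Qed.

(** In the full-rank factorization E = C R, idempotence cancels to R C = 1, an identity matrix of
    size [\rank E]. *)
Lemma mxtrace_idem (n : nat) (E : 'M[R]_n) : E *m E = E -> \tr E = (\rank E)%:R.
Proof.
move=> EE; rewrite -{1}(mulmx_base E) mxtrace_mulC.
suff -> : row_base E *m col_base E = 1%:M by rewrite mxtrace1.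
have /row_free_inj inj1 : row_free (row_base E) by exact: row_base_free.
have /row_full_inj inj2 : row_full (col_base E) by exact: col_base_full.
apply: inj2; apply: inj1.
by rewrite mulmx1 mulmxA mulmx_base -mulmxA mulmx_base.
Qed.

End Matrices.

(** * 2-forms of low rank *)

Section TwoForms.
Variables (R : numFieldType) (n : nat).
Implicit Types (x y z a b c d : 'cV[R]_n) (F h : 'M[R]_n).

Definition wedge a b : 'M[R]_n := a *m b^T - b *m a^T.

Lemma wedge_two_form a b : two_form (wedge a b).
Proof. by rewrite /two_form /wedge linearB /= !trmx_mul !trmxK opprB. Qed.

Lemma wedgeZl s a b : wedge (s *: a) b = s *: wedge a b.
Proof. by rewrite /wedge linearZ -scalemxAl -scalemxAr scalerBr. Qed.

Lemma two_form_vec F x : two_form F -> (F *m x)^T = - (x^T *m F).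
Proof. by move=> Fs; rewrite trmx_mul Fs mulmxN. Qed.

Lemma two_form_bil F x y : two_form F -> bil F x y = - bil F y x.
Proof.
move=> Fs; rewrite -mulN1r -[bil F x y]trace_mx11 -mxtrace_tr !trmx_mul trmxK Fs.
by rewrite mulNmx mulmxN linearN /= trace_mx11 mulN1r mulmxA.
Qed.

Lemma two_form_bil0 F x : two_form F -> bil F x x = 0.
Proof.
by move=> /(two_form_bil x x)/eqP; rewrite -addr_eq0 -mulr2n mulrn_eq0 => /eqP.
Qed.

(** One step of symplectic Gaussian elimination: a multiple of the wedge of F x and F y is
    subtracted, scaled so that [x] and [y] fall into the kernel. *)
Definition two_form_sub F x y := F - (bil F x y)^-1 *: wedge (F *m x) (F *m y).

Lemma wedge_vec F x y z : two_form F ->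
  wedge (F *m x) (F *m y) *m z = bil F z y *: (F *m x) - bil F z x *: (F *m y).
Proof.
move=> Fs; have Fz w : (F *m w)^T *m z = (bil F z w)%:M.
  by rewrite two_form_vec // mulNmx bil_mx (two_form_bil z w) // raddfN.
by rewrite /wedge mulmxBl -(mulmxA (F *m x)) -(mulmxA (F *m y)) !Fz !mul_mx_scalar.
Qed.

Lemma two_form_sub_vec F x y z : two_form F ->
  two_form_sub F x y *m z =
  F *m (z - (bil F x y)^-1 *: (bil F z y *: x - bil F z x *: y)).
Proof.
move=> Fs; rewrite /two_form_sub mulmxBl -scalemxAl wedge_vec //.
by rewrite mulmxBr -scalemxAr mulmxBr -!scalemxAr.
Qed.

(** The rank drops by two because the covectors x^T F and y^T F are independent, lie in the row
    space of [F], and span a plane meeting the row space of the remainder only in 0. *)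
Lemma two_form_subP F x y : two_form F -> bil F x y != 0 ->
  [/\ two_form (two_form_sub F x y), two_form_sub F x y *m x = 0,
      two_form_sub F x y *m y = 0 & (\rank (two_form_sub F x y) + 2 <= \rank F)%N].
Proof.
move=> Fs p0; set F' := two_form_sub F x y.
have F's : two_form F'.
  rewrite /two_form /F' /two_form_sub linearB linearZ /= Fs (wedge_two_form (F *m x) (F *m y)).
  by rewrite scalerN opprB opprK addrC.
have F'x : F' *m x = 0.
  rewrite two_form_sub_vec // two_form_bil0 // scale0r subr0 scalerA mulVf //.
  by rewrite scale1r subrr mulmx0.
have F'y : F' *m y = 0.
  rewrite two_form_sub_vec // two_form_bil0 // scale0r sub0r (two_form_bil y x) //.
  by rewrite scaleNr opprK scalerA mulVf // scale1r subrr mulmx0.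
split=> //.
(* [K] stacks the two covectors; [Z], the dual pair, is a right inverse of [K] that the remainder
   annihilates. *)
pose K := col_mx (x^T *m F) (y^T *m F).
pose p := bil F x y; pose Z := row_mx (p^-1 *: y) (- p^-1 *: x).
have KZ : K *m Z = 1%:M.
  rewrite /K /Z mul_col_row -!scalemxAr !bil_mx !two_form_bil0 // (two_form_bil y x) // -/p.
  rewrite !scale_scalar_mx mulVf // mulr0 mulr0 mulrNN mulVf // raddf0.
  by rewrite -scalar_mx_block.
have F'Z : F' *m Z = 0 by rewrite /Z mul_mx_row -!scalemxAr F'x F'y !scaler0 row_mx0.
have rK : (2 <= \rank K)%N.
  by have := mxrankM_maxl K Z; rewrite KZ mxrank1.
apply: leq_trans (leq_add (leqnn _) rK) _.
have cap0 : (F' :&: K)%MS = 0.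
  apply/eqP; rewrite -submx0; apply/rV_subP => v; rewrite sub_capmx.
  move=> /andP[/submxP[r ->] /submxP[s rs]]; rewrite rs.
  suff -> : s = 0 by rewrite mul0mx sub0mx.
  by rewrite -[s]mulmx1 -KZ mulmxA -rs -mulmxA F'Z mulmx0.
rewrite -(mxrank_disjoint_sum cap0) mxrankS // addsmx_sub; apply/andP; split; last first.
  by rewrite /K col_mx_sub !submxMl.
have -> : F' = (1%:M + p^-1 *: (F *m x *m y^T - F *m y *m x^T)) *m F.
  rewrite mulmxDl mul1mx -scalemxAl mulmxBl /F' /two_form_sub /wedge !two_form_vec //.
  by rewrite !mulmxN -!mulmxA -scalerN opprB opprK addrC [X in _ = _ + _ *: X]addrC addrC.
exact: submxMl.
Qed.

Lemma two_form_bil_neq0 F : two_form F -> F != 0 -> exists x y, bil F x y != 0.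
Proof.
move=> Fs /nonzero_entry[i [j Fij]]; exists (delta_mx i 0), (delta_mx j 0).
by rewrite /bil trmx_delta -rowE -colE !mxE.
Qed.

Lemma two_form_rank_lt2 F : two_form F -> (\rank F < 2)%N -> F = 0.
Proof.
move=> Fs rF; apply/eqP; apply: contraTT rF => /(two_form_bil_neq0 Fs)[x [y p0]].
by have [_ _ _ h] := two_form_subP Fs p0; rewrite -leqNgt; apply: leq_trans h; rewrite leq_addl.
Qed.

Lemma two_form_rank_le2 F : two_form F -> (\rank F <= 2)%N ->
  exists x y, F = wedge (F *m x) (F *m y).
Proof.
move=> Fs rF; have [->|/(two_form_bil_neq0 Fs)[x [y p0]]] := eqVneq F 0.
  by exists 0, 0; rewrite mulmx0 /wedge mul0mx subrr.
have [F's _ _ h] := two_form_subP Fs p0.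
exists ((bil F x y)^-1 *: x), y; apply/eqP; rewrite -scalemxAr wedgeZl -subr_eq0.
apply/eqP/(two_form_rank_lt2 F's).
by have := leq_trans h rF; rewrite -[X in (_ <= X)%N]add0n leq_add2r leqn0 => /eqP ->.
Qed.

Lemma two_form_rank_le4_sub F x y : two_form F -> (\rank F <= 4)%N -> bil F x y != 0 ->
  exists z w, [/\ two_form_sub F x y = wedge (two_form_sub F x y *m z) (two_form_sub F x y *m w),
    two_form_sub F x y *m x = 0 & two_form_sub F x y *m y = 0].
Proof.
move=> Fs rF p0; have [F's F'x F'y h] := two_form_subP Fs p0.
have [z [w F'E]] : exists z w,
    two_form_sub F x y = wedge (two_form_sub F x y *m z) (two_form_sub F x y *m w).
  by apply: two_form_rank_le2 => //; rewrite -(leq_add2r 2); apply: leq_trans rF.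
by exists z, w.
Qed.

Lemma two_form_rank_le4 F : two_form F -> (\rank F <= 4)%N ->
  exists x y z w, F = wedge (F *m x) (F *m y) + wedge (F *m z) (F *m w).
Proof.
move=> Fs rF; have [->|/(two_form_bil_neq0 Fs)[x [y p0]]] := eqVneq F 0.
  by exists 0, 0, 0, 0; rewrite mulmx0 /wedge mul0mx subrr addr0.
have [z [w [F'E _ _]]] := two_form_rank_le4_sub Fs rF p0.
rewrite !two_form_sub_vec // in F'E.
eexists ((bil F x y)^-1 *: x), y, _, _.
by rewrite -[in LHS](subrK ((bil F x y)^-1 *: wedge (F *m x) (F *m y)) F) addrC
  -/(two_form_sub F x y) F'E -scalemxAr wedgeZl.
Qed.

End TwoForms.

(** * Quadratic relation for products of antisymmetric 4x4 matrices *)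

Section Quartic.
Variable R : numFieldType.

Definition symp4 : 'M[R]_4 := \matrix_(i, j)
  nth 0 (nth [::] [:: [:: 0; 1; 0; 0]; [:: -1; 0; 0; 0]; [:: 0; 0; 0; 1]; [:: 0; 0; -1; 0]] i) j.

Definition antisym4 (p q r s t u : R) : 'M[R]_4 := \matrix_(i, j)
  nth 0 (nth [::] [:: [:: 0; p; q; r]; [:: - p; 0; s; t]; [:: - q; - s; 0; u];
    [:: - r; - t; - u; 0]] i) j.

(** For antisymmetric 4x4 matrices J and Y, the characteristic polynomial of J Y is the square of a
    quadratic that already annihilates J Y. Its constant term is Pf(J) Pf(Y); here Pf(J) = 1. *)
Lemma symp4_quadratic (p q r s t u : R) : let N := symp4 *m antisym4 p q r s t u in
  2 *: (N *m N) = \tr N *: N - (2 * (p * u - q * t + r * s))%:M.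
Proof.
move=> N.
have -> : N = \matrix_(i, j) nth 0 (nth [::]
    [:: [:: - p; 0; s; t]; [:: 0; - p; - q; - r]; [:: - r; - t; - u; 0]; [:: q; s; 0; - u]] i) j.
  apply/matrixP => -[[|[|[|[|//]]]] hi] [[|[|[|[|//]]]] hj];
  by rewrite !mxE !big_ord_recl big_ord0 !mxE /=; ring.
apply/matrixP => -[[|[|[|[|//]]]] hi] [[|[|[|[|//]]]] hj];
rewrite !mxE /mxtrace !big_ord_recl !big_ord0 !mxE /= ?mulr1n ?mulr0n; ring.
Qed.

Lemma antisym4E (Y : 'M[R]_4) : Y^T = - Y ->
  let y (i j : nat) := Y (inord i) (inord j) in
  Y = antisym4 (y 0 1) (y 0 2) (y 0 3) (y 1 2) (y 1 3) (y 2 3).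
Proof.
move=> Ys y.
have Y' i j : Y i j = - Y j i by have := congr1 (fun M : 'M_4 => M j i) Ys; rewrite !mxE.
have Y0 i : Y i i = 0.
  by have /eqP := Y' i i; rewrite -addr_eq0 -mulr2n mulrn_eq0 => /eqP.
apply/matrixP => -[[|[|[|[|//]]]] hi] [[|[|[|[|//]]]] hj]; rewrite mxE /= /y;
  try (by rewrite -[RHS](Y0 (Ordinal hi)); congr (Y _ _); apply/val_inj);
  try (by congr (Y _ _); apply/val_inj; rewrite /= inordK);
  by rewrite -Y'; congr (Y _ _); apply/val_inj; rewrite /= inordK.
Qed.

Variable n : nat.
Implicit Types (a b c d : 'cV[R]_n) (h F : 'M[R]_n).

Definition cols4 a b c d : 'M[R]_(n, 4) := \matrix_(i, j) (nth 0 [:: a; b; c; d] j) i 0.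

Lemma wedge_cols4 a b c d :
  wedge a b + wedge c d = cols4 a b c d *m symp4 *m (cols4 a b c d)^T.
Proof.
apply/matrixP => i j; rewrite !mxE !big_ord1 !big_ord_recl !big_ord0 !mxE.
rewrite !big_ord_recl !big_ord0 !mxE /=; ring.
Qed.

(* The Gram determinant of a, b, c, d with respect to h, as a Pfaffian. *)
Definition gram4 h a b c d : R :=
  let s i j := bil h (nth 0 [:: a; b; c; d] i) (nth 0 [:: a; b; c; d] j) in
  let y i j := s i 0 * s 1 j - s i 1 * s 0 j + s i 2 * s 3 j - s i 3 * s 2 j in
  y 0 1 * y 2 3 - y 0 2 * y 1 3 + y 0 3 * y 1 2.

(** With F = C J C^T and S = C^T h C, the matrix [B] factors as L K, while K L = J (S J S) is a
    product of two antisymmetric 4x4 matrices. So the traces of powers agree, and the quadratic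
    relation multiplied by L and K becomes the cubic one. The Pfaffian of S J S is det S, the Gram
    determinant. *)
Lemma wedge_quartic h F a b c d : h^T = h -> F = wedge a b + wedge c d ->
  let B := (h *m F) *m (h *m F) in let q := gram4 h a b c d in
  \tr (B *m B) = (\tr B) ^+ 2 / 2 - 4 * q /\
  B *m B *m B = (\tr B / 2) *: (B *m B) - q *: B.
Proof.
move=> hs -> B q; pose C := cols4 a b c d; pose S := C^T *m h *m C.
pose Y := S *m symp4 *m S; pose N := symp4 *m Y.
pose L := h *m C; pose K := symp4 *m S *m symp4 *m C^T.
have BE : B = L *m K by rewrite /B wedge_cols4 -/C /K /L /S !mulmxA.
have KL : K *m L = N by rewrite /K /L /N /Y /S !mulmxA.
clearbody L K B.
have Ss : S^T = S by rewrite /S !trmx_mul trmxK hs mulmxA.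
have SE i j : S (inord i) (inord j) =
    bil h (nth 0 [:: a; b; c; d] (inord i : 'I_4)) (nth 0 [:: a; b; c; d] (inord j : 'I_4)).
  rewrite /S /bil !mxE; apply: eq_bigr => k _; rewrite !mxE; congr (_ * _).
  by apply: eq_bigr => l _; rewrite !mxE.
clearbody S.
have Js : symp4^T = - symp4.
  by apply/matrixP => -[[|[|[|[|//]]]] hi] [[|[|[|[|//]]]] hj]; rewrite !mxE /= ?oppr0 ?opprK.
have Ys : Y^T = - Y by rewrite /Y !trmx_mul Ss Js mulNmx mulmxN mulmxA.
have YE (i j : nat) : Y (inord i) (inord j) =
    S (inord i) (inord 0) * S (inord 1) (inord j) - S (inord i) (inord 1) * S (inord 0) (inord j)
    + S (inord i) (inord 2) * S (inord 3) (inord j) - S (inord i) (inord 3) * S (inord 2) (inord j).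
  have -> : inord 0 = ord0 :> 'I_4 by apply/val_inj; rewrite /= inordK.
  have -> : inord 1 = lift ord0 ord0 :> 'I_4 by apply/val_inj; rewrite /= inordK.
  have -> : inord 2 = lift ord0 (lift ord0 ord0) :> 'I_4 by apply/val_inj; rewrite /= inordK.
  have -> : inord 3 = lift ord0 (lift ord0 (lift ord0 ord0)) :> 'I_4.
    by apply/val_inj; rewrite /= inordK.
  rewrite /Y mxE !big_ord_recl big_ord0 ![(S *m symp4) _ _]mxE !big_ord_recl !big_ord0.
  by rewrite ![symp4 _ _]mxE /=; ring.
have NN : 2 *: (N *m N) = \tr N *: N - (2 * q)%:M.
  rewrite /N (antisym4E Ys) symp4_quadratic; congr (_ - (2 * _)%:M).
  by rewrite /q /gram4 !YE !SE !inordK.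
have trB : \tr B = \tr N by rewrite BE mxtrace_mulC KL.
have BB : B *m B = L *m N *m K by rewrite BE -KL !mulmxA.
have BBB : B *m B *m B = L *m (N *m N) *m K.
  rewrite BB BE; have -> : L *m N *m K *m (L *m K) = L *m N *m (K *m L) *m K by rewrite !mulmxA.
  by rewrite KL !mulmxA.
have n2 : (2 : R) != 0 by rewrite pnatr_eq0.
have trBB : \tr (B *m B) = \tr (N *m N) by rewrite BB -mulmxA mxtrace_mulC -mulmxA KL.
split.
  have := congr1 mxtrace NN; rewrite linearB !linearZ /= mxtrace_scalar -trB -trBB => e.
  by apply: (mulfI n2); rewrite e -mulr_natr; field.
apply: (scalerI n2); have -> : 2 *: (B *m B *m B) = L *m (2 *: (N *m N)) *m K.
  by rewrite BBB -scalemxAr -scalemxAl.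
rewrite NN mulmxBr mulmxBl -scalemxAr -scalemxAl.
rewrite -BB -trB mul_mx_scalar -scalemxAl -BE scalerBr !scalerA; congr (_ *: _ - _).
by field.
Qed.

End Quartic.

(** * Lorentzian geometry *)

Section Lorentzian.
Variable R : rcfType.

Lemma lorentz_unitmx (n : nat) (g : 'M[R]_n) : lorentz_metric g -> g \in unitmx.
Proof.
case=> _ [P _ /(congr1 (fun X => X \in unitmx))].
rewrite !unitmx_mul => /esym dE.
suff : diag_mx (\row_(i < n) (if (i : nat) == 0%N then -1 else 1)) \in @unitmx R n.
  by rewrite dE => /andP[/andP[]].
rewrite unitmxE det_diag unitfE; apply/prodf_neq0 => i _; rewrite mxE.
by case: ifP; rewrite ?oppr_eq0 oner_eq0.
Qed.

(** The metric is positive definite on the orthogonal complement of the timelike basis vector [e].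
    The combination [z] of [t] and [w] lies there, and g(z,z) >= 0 with g(t,t) < 0 forces g(w,w) >
    0, unless g(e,w) = 0 and [w] itself lies there. Later sections use the signature only through
    this property. *)
Lemma lorentz_timelike_perp (n : nat) (g : 'M[R]_n) (t w : 'cV[R]_n) :
  (0 < n)%N -> lorentz_metric g ->
  bil g t t < 0 -> bil g t w = 0 -> w != 0 -> 0 < bil g w w.
Proof.
case: n g t w => // n g t w _ [gs [P Pu PgP]] tt tw w0.
have bP x y : bil g (P *m x) (P *m y) =
    - (x 0 0 * y 0 0) + \sum_(i < n) x (lift 0 i) 0 * y (lift 0 i) 0.
  rewrite /bil trmx_mul -!mulmxA (mulmxA g) (mulmxA P^T) mulmxA (mulmxA P^T) PgP.
  rewrite -mulmxA mul_diag_mx mxE big_ord_recl !mxE /= mulN1r mulrN; congr (_ + _).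
  by apply: eq_bigr => i _; rewrite !mxE /= mul1r.
pose e : 'cV[R]_n.+1 := P *m delta_mx 0 0.
have eP y : bil g e (P *m y) = - y 0 0.
  rewrite bP mxE eqxx mul1r big1 ?addr0 // => i _.
  by rewrite mxE mul0r.
have e_perp x : bil g e x = 0 -> 0 <= bil g x x ?= iff (x == 0).
  rewrite -[x](mulKVmx Pu) eP bP; set y := invmx P *m x => /eqP; rewrite oppr_eq0 => /eqP y0.
  rewrite y0 mul0r oppr0 add0r; apply/leifP; case: eqP => [/(congr1 (mulmx (invmx P)))|] Py.
    move: Py; rewrite mulKmx // mulmx0 => ->.
    by rewrite big1 // => i _; rewrite mxE mul0r.
  rewrite lt_def sumr_ge0 ?andbT => [|i _]; last by rewrite -expr2 sqr_ge0.
  apply/eqP => /psumr_eq0P y1; apply: Py; suff -> : y = 0 by rewrite mulmx0.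
  apply/colP => i; rewrite [RHS]mxE; case: (unliftP 0 i) => [j ->|->] //.
  apply/eqP; rewrite -sqrf_eq0 expr2 y1 // => k _; by rewrite -expr2 sqr_ge0.
pose z := bil g e t *: w - bil g e w *: t.
have ez : bil g e z = 0 by rewrite /z !bilE; ring.
have zz : bil g z z = bil g e t ^+ 2 * bil g w w + bil g e w ^+ 2 * bil g t t.
  by rewrite /z !bilE (bilC gs w t) tw; ring.
have [ew|ew] := eqVneq (bil g e w) 0.
  by have := e_perp w ew => /leifP; rewrite (negPf w0).
have {}zz0 : 0 <= bil g z z by have [] := e_perp z ez.
rewrite zz in zz0.
have h : 0 < bil g e w ^+ 2 by rewrite lt_def sqrf_eq0 ew sqr_ge0.
have h2 := sqr_ge0 (bil g e t).
rewrite ltNge; apply/negP => h3.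
have : bil g e t ^+ 2 * bil g w w <= 0 by rewrite mulr_ge0_le0.
have : bil g e w ^+ 2 * bil g t t < 0 by rewrite pmulr_rlt0.
lra.
Qed.

End Lorentzian.

(** * Causal vectors and orthogonal projectors *)

Section Causal.
Variables (R : rcfType) (n : nat) (g : 'M[R]_n).
Hypothesis gs : g^T = g.
Hypothesis lor : forall t w : 'cV[R]_n,
  bil g t t < 0 -> bil g t w = 0 -> w != 0 -> 0 < bil g w w.
Implicit Types (t u v w e k : 'cV[R]_n) (E X N : 'M[R]_n).

Let bC := bilC gs.

Lemma timelike_perp_ge0 t w : bil g t t < 0 -> bil g t w = 0 -> 0 <= bil g w w.
Proof.
move=> tt tw; have [->|w0] := eqVneq w 0; first by rewrite bil0l.
exact/ltW/(lor tt).
Qed.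

Lemma causal_bil_neq0 t u : bil g t t < 0 -> bil g u u <= 0 -> u != 0 -> bil g t u != 0.
Proof. by move=> tt uu u0; apply/eqP => /(lor tt)/(_ u0); rewrite ltNge uu. Qed.

(** Subtracting from [u] the multiple of [k] that makes the difference orthogonal to [t] leaves a
    null vector, hence zero. *)
Lemma null_orthogonal_colinear t k u : bil g t t < 0 ->
  bil g k k = 0 -> bil g u u = 0 -> bil g k u = 0 -> k != 0 -> exists a, u = a *: k.
Proof.
move=> tt kk uu ku k0; have tk := causal_bil_neq0 tt (eq_ind_r (fun x => x <= 0) (lexx 0) kk) k0.
exists (bil g t u / bil g t k); apply/eqP; rewrite -subr_eq0; apply/contraT => d0.
suff : 0 < bil g (u - (bil g t u / bil g t k) *: k) (u - (bil g t u / bil g t k) *: k).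
  by rewrite !bilE (bC u k) kk uu ku !(mulr0, addr0, subr0, oppr0) ltxx.
apply: (lor tt) => //; rewrite !bilE; field; exact: tk.
Qed.

(** With a = g(t,u) and b = g(t,v), both negative, b u - a v is orthogonal to [t]; expanding its
    nonnegative square isolates g(u,v). *)
Lemma future_bil_lt0 t u v : bil g t t < 0 -> bil g u u < 0 -> bil g t u < 0 ->
  future_causal g t v -> bil g u v < 0.
Proof.
move=> tt uu tu [[v0 vv] tv].
pose a := bil g t u; pose b := bil g t v.
have : 0 <= bil g (b *: u - a *: v) (b *: u - a *: v).
  by apply: (timelike_perp_ge0 tt); rewrite !bilE /a /b; ring.
have -> : bil g (b *: u - a *: v) (b *: u - a *: v) =
    b ^+ 2 * bil g u u + a ^+ 2 * bil g v v - 2 * (a * b) * bil g u v.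
  by rewrite !bilE (bC v u); ring.
have ab : 0 < a * b by rewrite nmulr_lgt0.
have h1 : b ^+ 2 * bil g u u < 0 by rewrite pmulr_rlt0 // exprn_even_gt0 //= lt_eqF.
have h2 : a ^+ 2 * bil g v v <= 0 by rewrite mulr_ge0_le0 // sqr_ge0.
move=> h; have : a * b * bil g u v < 0 by lra.
by rewrite pmulr_rlt0.
Qed.

Definition spacelike_im E := forall w, E *m w != 0 -> 0 < bil g (E *m w) (E *m w).

(** For an idempotent, symmetry with respect to [g] says that image and kernel are orthogonal. *)
Definition g_projector E := g_symmetric g E /\ E *m E = E.

Lemma g_projector_compl E : g_projector E -> g_projector (1%:M - E).
Proof.
move=> [sE EE]; split; first by apply: g_symD (g_sym_scalar gs _) (g_symN sE).
by rewrite mulmxBl mul1mx mulmxBr mulmx1 EE subrr subr0.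
Qed.

Lemma projector_compl_mul E : g_projector E -> E *m (1%:M - E) = 0.
Proof. by move=> [_ EE]; rewrite mulmxBr mulmx1 EE subrr. Qed.

Lemma bil_projector E X u v : g_projector E -> E *m X = 0 -> bil g (E *m u) (X *m v) = 0.
Proof. by move=> [sE EE] EX; rewrite -(bil_sym gs) // mulmxA EX mul0mx bil0r. Qed.

Lemma bil_projector_split E u : g_projector E ->
  bil g u u = bil g (E *m u) (E *m u) + bil g ((1%:M - E) *m u) ((1%:M - E) *m u).
Proof.
move=> pE; have h := bil_projector u u pE (projector_compl_mul pE).
have {1 2}-> : u = E *m u + (1%:M - E) *m u.
  by rewrite -mulmxDl addrC subrK mul1mx.
by rewrite [LHS]bilDl !bilDr h (bC _ (E *m u)) h addr0 add0r.
Qed.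

Lemma timelike_projector t E : bil g t t < 0 -> g_projector E ->
  bil g (E *m t) (E *m t) < 0 \/ bil g ((1%:M - E) *m t) ((1%:M - E) *m t) < 0.
Proof.
move=> tt pE; move: tt; rewrite (bil_projector_split t pE) => tt.
have [|h] := ltP (bil g (E *m t) (E *m t)) 0; [by left | right; lra].
Qed.

Lemma spacelike_im_perp t E : bil g t t < 0 -> (forall w, bil g t (E *m w) = 0) ->
  spacelike_im E.
Proof. by move=> tt h w; apply: (lor tt). Qed.

Lemma spacelike_im_compl E t : g_projector E -> bil g (E *m t) (E *m t) < 0 ->
  spacelike_im (1%:M - E).
Proof.
move=> pE tt; apply: (spacelike_im_perp tt) => w.
exact: bil_projector pE (projector_compl_mul pE).
Qed.

(** Splits the unit vector [e] off the image; the sign [s] lets spacelike and timelike vectors be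
    treated together. *)
Lemma projector_sub_outer E e s : g_projector E -> E *m e = e -> s * s = 1 ->
  bil g e e = s -> let E' := E - s *: outer g e e in
  [/\ g_projector E', E *m E' = E', (forall w, bil g e (E' *m w) = 0) & \tr E' = \tr E - 1].
Proof.
move=> [sE EE] Ee ss ee E'.
have sE' : g_symmetric g E' by apply/(g_symD sE)/g_symN/g_symZ/(outer_sym gs).
have EE' : E *m E' = E' by rewrite /E' mulmxBr EE -scalemxAr mul_outer Ee.
have E'e : E' *m e = 0 by rewrite /E' mulmxBl Ee -scalemxAl outer_vec ee scalerA ss scale1r subrr.
split=> //.
- split=> //; rewrite {1}/E' mulmxBl EE' -scalemxAl (outer_mulr gs) // E'e.
  by rewrite /outer trmx0 mulmx0 mul0mx scaler0 subr0.
- by move=> w; rewrite (bil_sym gs) // E'e bil0l.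
- by rewrite /E' linearB linearZ /= tr_outer ee ss.
Qed.

(** Gram-Schmidt by induction on the trace, which for a projector is the dimension of its image. *)
Lemma orthonormal_projector (r : nat) E : g_projector E -> spacelike_im E -> \tr E = r%:R ->
  exists c : 'I_r -> 'cV[R]_n,
    (forall i j, bil g (c i) (c j) = (i == j)%:R) /\ E = \sum_i outer g (c i) (c i).
Proof.
elim: r E => [|r IHr] E pE spE trE.
  exists (fun=> 0); split=> [[]//|]; rewrite big_ord0; apply/eqP; rewrite -mxrank_eq0.
  by move: trE; rewrite (mxtrace_idem pE.2) => /eqP; rewrite eqr_nat.
have [w Ew0] : exists w, E *m w != 0.
  have E0 : E != 0.
    by apply/eqP => E0; move: trE; rewrite E0 mxtrace0 => /esym/eqP; rewrite pnatr_eq0.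
  exact: nonzero_vec.
have q0 := spE w Ew0; set x := E *m w in q0.
pose a := Num.sqrt (bil g x x).
have a0 : a != 0 by rewrite sqrtr_eq0 -ltNge.
pose e := a^-1 *: x.
have Ee : E *m e = e by rewrite /e /x -scalemxAr mulmxA pE.2.
have ee : bil g e e = 1.
  rewrite /e !bilE; have -> : bil g x x = a ^+ 2 by rewrite sqr_sqrtr // ltW.
  by field; exact: a0.
have [pE' EE' eE' trE'] := projector_sub_outer pE Ee (mulr1 1) ee.
rewrite scale1r in pE' EE' eE' trE'; set E' := E - _ in pE' EE' eE' trE'.
have [||c [cc E'c]] := IHr E' pE'.
- by move=> y; rewrite -EE' -mulmxA; apply: spE.
- by rewrite trE' trE -natr1 addrK.
have E'ci i : E' *m c i = c i.
  rewrite E'c mulmx_suml (bigD1 i) //= outer_vec cc eqxx scale1r big1 ?addr0 // => j /negPf ji.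
  by rewrite outer_vec cc ji scale0r.
have ec i : bil g e (c i) = 0 by rewrite -E'ci.
(* Index 0 carries [e], the other indices the vectors of the induction hypothesis. *)
exists (fun i => oapp c e (unlift ord0 i)); split=> [i j|].
  case: (unliftP ord0 i) => [i'|] ->; case: (unliftP ord0 j) => [j'|] -> /=.
  - by rewrite cc (inj_eq lift_inj).
  - by rewrite bC ec.
  - by rewrite ec.
  - by rewrite ee.
rewrite big_ord_recl unlift_none /=; under eq_bigr do rewrite liftK /=.
by rewrite -E'c addrC /E' subrK.
Qed.

Lemma orthonormal_projector2 E : g_projector E -> spacelike_im E -> \tr E = 2 ->
  exists c d, [/\ bil g c c = 1, bil g d d = 1, bil g c d = 0, E *m c = c /\ E *m d = d
    & E = outer g c c + outer g d d].
Proof.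
move=> pE sE /(orthonormal_projector pE sE)[c [cc ->]].
exists (c ord0), (c (lift ord0 ord0)); rewrite !big_ord_recl big_ord0 addr0 !cc; split=> //.
by rewrite !mulmxDl !outer_vec !cc !scale0r !scale1r addr0 add0r.
Qed.

Lemma normalize_timelike E t : E *m E = E -> bil g (E *m t) (E *m t) < 0 ->
  exists2 e, E *m e = e & bil g e e = -1.
Proof.
move=> EE; set x := E *m t => xx; pose a := Num.sqrt (- bil g x x).
have a0 : a != 0 by rewrite sqrtr_eq0 -ltNge oppr_gt0.
exists (a^-1 *: x); first by rewrite /x -scalemxAr mulmxA EE.
rewrite !bilE; have -> : bil g x x = - a ^+ 2.
  by rewrite sqr_sqrtr ?opprK // oppr_ge0 ltW.
by field; exact: a0.
Qed.

Lemma projector_timelike E e : g_projector E -> E *m e = e -> bil g e e = -1 ->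
  [/\ g_projector (E + outer g e e), spacelike_im (E + outer g e e),
   (forall w, bil g e ((E + outer g e e) *m w) = 0) & \tr (E + outer g e e) = \tr E - 1].
Proof.
move=> pE Ee ee; have := projector_sub_outer pE Ee _ ee.
rewrite mulrNN mulr1 scaleN1r opprK => /(_ erefl)[pE' _ eE' trE'].
by split=> //; apply: (@spacelike_im_perp e) => //; rewrite ee oppr_lt0.
Qed.

(** The columns of [C] form an orthonormal basis of the orthogonal complement of [u]; the second
    equation is the resolution of the projector onto it. *)
Lemma orthonormal_frame u : bil g u u = -1 ->
  exists r (C : 'M[R]_(n, r)), C^T *m g *m C = 1%:M /\ 1%:M + outer g u u = C *m C^T *m g.
Proof.
move=> uu; have p1 : g_projector 1%:M by split; [exact: g_sym_scalar | rewrite mul1mx].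
have [pE sE _ _] := projector_timelike p1 (mul1mx u) uu.
have := mxtrace_idem pE.2; move: (\rank _) => r trE.
have [c [cc Ec]] := orthonormal_projector pE sE trE.
exists _, (\matrix_(i, j) c j i 0); split.
  apply/matrixP => i j; have := cc i j; rewrite /bil !mxE => <-.
  apply: eq_bigr => k _; rewrite !mxE; congr (_ * _).
  by apply: eq_bigr => l _; rewrite !mxE.
rewrite Ec /outer -mulmx_suml; congr (_ *m _); apply/matrixP => i j.
by rewrite summxE !mxE; apply: eq_bigr => k _; rewrite !mxE big_ord1 !mxE.
Qed.

End Causal.

(** * The dominant energy condition *)

Section AntisymmetricNorm.
Variables (R : realFieldType) (r : nat).
Implicit Types (x y : 'cV[R]_r) (H : 'M[R]_r).

Lemma bil1_ge0 x : 0 <= bil 1%:M x x.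
Proof.
by rewrite /bil mulmx1 mxE sumr_ge0 // => i _; rewrite !mxE -expr2 sqr_ge0.
Qed.

Lemma bil1_eq0 x : bil 1%:M x x = 0 -> x = 0.
Proof.
rewrite /bil mulmx1 mxE => /psumr_eq0P h; apply/colP => i; rewrite [RHS]mxE.
apply/eqP; rewrite -sqrf_eq0 expr2; have := h _ i isT; rewrite !mxE => -> // j _.
by rewrite !mxE -expr2 sqr_ge0.
Qed.

Lemma mxtrace_antisym_sqr_le0 H : H^T = - H -> \tr (H *m H) <= 0.
Proof.
move=> Hs; rewrite -[X in _ *m X]opprK -Hs mulmxN linearN /= oppr_le0 /mxtrace.
by apply: sumr_ge0 => i _; rewrite mxE sumr_ge0 // => j _; rewrite !mxE -expr2 sqr_ge0.
Qed.

(* Nonnegativity of the norm of |x|^2 H - (y x^T - x y^T) with y = H x. *)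
Lemma antisym_vec_norm H x : H^T = - H ->
  2 * bil 1%:M (H *m x) (H *m x) <= - \tr (H *m H) * bil 1%:M x x.
Proof.
move=> Hs; set y := H *m x; set s := bil 1%:M x x.
have bC := @bilC R r 1%:M (trmx1 _ _).
have Ht u v : bil 1%:M u (H *m v) = - bil 1%:M (H *m u) v.
  by rewrite /bil trmx_mul Hs !mulmx1 mulmxN mulNmx [X in _ = - X]mxE opprK mulmxA.
have xy : bil 1%:M x y = 0.
  by have := Ht x x; rewrite -/y (bC y x) => /eqP; rewrite -addr_eq0 -mulr2n mulrn_eq0 => /eqP.
have [s0|s0] := eqVneq s 0.
  by rewrite s0 /y (bil1_eq0 s0) mulmx0 bil0l !mulr0.
pose W := outer 1%:M y x - outer 1%:M x y.
have Ws : W^T = - W.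
  by rewrite /W /outer !mulmx1 linearB /= !trmx_mul !trmxK opprB.
have trHW : \tr (H *m W) = - 2 * bil 1%:M y y.
  by rewrite /W mulmxBr linearB /= !mul_outer !tr_outer Ht -/y; ring.
have trWW : \tr (W *m W) = - 2 * s * bil 1%:M y y.
  rewrite /W mulmxBl !mulmxBr !linearB /= !outer_mul !linearZ /= !tr_outer xy (bC y x) xy -/s.
  by ring.
clearbody W; have := @mxtrace_antisym_sqr_le0 (s *: H - W).
rewrite linearB linearZ /= Hs Ws => /(_ _).
rewrite scalerN opprK opprB addrC => /(_ erefl).
rewrite mulmxBl !mulmxBr !linearB /= -!scalemxAl -!scalemxAr !linearZ /=.
rewrite (mxtrace_mulC W H) trHW trWW => h.
have s1 : 0 < s by rewrite lt_def s0 bil1_ge0.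
rewrite -(ler_pM2l s1); lra.
Qed.

End AntisymmetricNorm.

(** * Superenergy tensors contracted with a unit timelike vector *)

Section Superenergy.
Variables (R : rcfType) (n : nat) (g : 'M[R]_n).
Hypothesis gs : g^T = g.
Hypothesis gu : g \in unitmx.
Implicit Types (t u v w : 'cV[R]_n) (F : 'M[R]_n).

Lemma superenergyE F : two_form F -> let A := invmx g *m F in
  superenergy g F = (4^-1 * \tr (A *m A))%:M - A *m A.
Proof.
move=> Fs A; by rewrite /superenergy Fs mulmxN !linearN /= mulrN !raddfN /= opprK addrC -!mulmxA.
Qed.

Lemma bil_mixed F u v : bil g u ((invmx g *m F) *m v) = bil F u v.
Proof. by rewrite /bil !mulmxA mulmxK. Qed.

Hypothesis lor : forall t w : 'cV[R]_n,
  bil g t t < 0 -> bil g t w = 0 -> w != 0 -> 0 < bil g w w.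

(** Relative to [u], let [e] and [H] be the electric and magnetic parts of [F], v = v0 u + C x and y
    = H x. Then v0 T(u,v) = |v0 e + y|^2 / 2 + (- v0^2 tr(H^2) - 2 |y|^2) / 4, and the last bracket
    is nonnegative by [antisym_vec_norm], because |x| <= v0 for causal [v]. *)
Lemma superenergy_unit_timelike F u v : two_form F -> bil g u u = -1 ->
  bil g v v <= 0 -> bil g u v < 0 -> 0 <= bil g u (superenergy g F *m v).
Proof.
move=> Fs uu vv uv; have [r [C [CC CCg]]] := orthonormal_frame gs lor uu.
have gi : invmx g = C *m C^T - u *m u^T.
  by rewrite -[C *m _](mulmxK gu) -CCg mulmxDl mul1mx /outer mulmxK // addrK.
have Fuu : u^T *m F *m u = 0 by rewrite bil_mx two_form_bil0 // raddf0.
rewrite superenergyE // mulmxBl; set A := invmx g *m F.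
pose e := C^T *m F *m u; pose H := C^T *m F *m C; pose x := C^T *m g *m v.
have Hs : H^T = - H by rewrite /H !trmx_mul trmxK Fs mulNmx mulmxN mulmxA.
have FuC : u^T *m F *m C = - e^T.
  by rewrite /e !trmx_mul trmxK Fs mulNmx mulmxN opprK mulmxA.
pose v0 := - bil g u v.
have vE : v = v0 *: u + C *m x.
  by rewrite /x !mulmxA -CCg mulmxDl mul1mx outer_vec /v0 scaleNr addrC addrK.
have CFv : C^T *m F *m v = v0 *: e + H *m x.
  by rewrite {1}vE mulmxDr -scalemxAr /H !mulmxA.
have xx : bil 1%:M x x = bil g v v + v0 ^+ 2.
  rewrite /bil mulmx1 /x !trmx_mul trmxK gs -!mulmxA (mulmxA C) (mulmxA (C *m _)) -CCg.
  rewrite mulmxDl mul1mx outer_vec !mulmxDr -!scalemxAr !mulmxA mxE [X in _ + X]mxE.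
  by rewrite -/(bil g v v) -/(bil g v u) (bilC gs v u) /v0 sqrrN.
have uAAv : bil g u (A *m (A *m v)) = - (v0 * bil 1%:M e e + bil 1%:M e (H *m x)).
  rewrite bil_mixed; have -> : bil F u (A *m v) = - bil 1%:M e (C^T *m F *m v).
    rewrite /bil mulmx1; suff -> : u^T *m F *m (A *m v) = - (e^T *m (C^T *m F *m v)) by rewrite mxE.
    rewrite /A gi -[RHS]mulNmx -FuC !mulmxBl mulmxBr !mulmxA Fuu.
    by rewrite !mul0mx subr0.
  by rewrite CFv !bilE.
have trAA : \tr (A *m A) = \tr (H *m H) + 2 * bil 1%:M e e.
  have tre : \tr (C *m C^T *m F *m (u *m u^T *m F)) = - bil 1%:M e e.
    have -> : C *m C^T *m F *m (u *m u^T *m F) = C *m (e *m (u^T *m F)) by rewrite /e !mulmxA.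
    rewrite mxtrace_mulC -mulmxA FuC mulmxN linearN /= mxtrace_mulC.
    by rewrite /bil mulmx1 trace_mx11.
  have trCC : \tr (C *m C^T *m F *m (C *m C^T *m F)) = \tr (H *m H).
    have -> : C *m C^T *m F *m (C *m C^T *m F) = C *m (H *m (C^T *m F)) by rewrite /H !mulmxA.
    by rewrite mxtrace_mulC -mulmxA.
  have truu : u *m u^T *m F *m (u *m u^T *m F) = 0.
    have -> : u *m u^T *m F *m (u *m u^T *m F) = u *m (u^T *m F *m u) *m (u^T *m F).
      by rewrite !mulmxA.
    by rewrite Fuu mulmx0 mul0mx.
  rewrite /A gi mulmxBl mulmxBl !mulmxBr !linearB /= tre trCC truu mxtrace0.
  by rewrite (mxtrace_mulC (u *m u^T *m F)) tre; ring.
have v0_gt0 : 0 < v0 by rewrite oppr_gt0.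
have := antisym_vec_norm x Hs; set y := H *m x.
have h1 : 0 <= bil 1%:M (v0 *: e + y) (v0 *: e + y) by exact: bil1_ge0.
have h2 : 0 <= - \tr (H *m H) by rewrite oppr_ge0 mxtrace_antisym_sqr_le0.
move=> h3; have h4 : - \tr (H *m H) * bil 1%:M x x <= - \tr (H *m H) * v0 ^+ 2.
  by rewrite ler_wpM2l // xx; lra.
rewrite mul_scalar_mx bilDr bilZr bilNr -(mulmxA A A v) uAAv trAA -/y -(pmulr_rge0 _ v0_gt0).
have -> : bil g u v = - v0 by rewrite /v0 opprK.
move: h1; rewrite !bilE (@bilC _ _ 1%:M (trmx1 _ _) y e).
move: h3 h4; lra.
Qed.

End Superenergy.

(** * Passage to null vectors, and consequences of the energy condition *)

Section DominantEnergy.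
Variables (R : rcfType) (n : nat) (g : 'M[R]_n) (t0 : 'cV[R]_n).
Hypothesis gs : g^T = g.
Hypothesis lor : forall t w : 'cV[R]_n,
  bil g t t < 0 -> bil g t w = 0 -> w != 0 -> 0 < bil g w w.
Hypothesis tt0 : bil g t0 t0 < 0.
Implicit Types (t u v w : 'cV[R]_n) (F T : 'M[R]_n).

(** The limit of [e] to 0 made explicit: for negative [x], the value e = -x / (2 (|y| + 1)) gives x
    + e y <= x / 2 < 0. *)
Lemma nonneg_of_small_perturbation (x y : R) : (forall e, 0 < e -> 0 <= x + e * y) -> 0 <= x.
Proof.
move=> h; rewrite leNgt; apply/negP => x0.
have d0 : 0 < 2 * (`|y| + 1) by have := normr_ge0 y; lra.
have := h (- x / (2 * (`|y| + 1))); rewrite divr_gt0 ?oppr_gt0 // => /(_ erefl).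
suff : - x / (2 * (`|y| + 1)) * y <= - x / 2 by lra.
rewrite mulrAC ler_pdivrMr //; have := ler_norm y; nra.
Qed.

(** Scaling reduces a timelike [u] to a unit vector; a causal [u] is the limit of the timelike
    vectors u + e t0. *)
Lemma superenergy_dominant F : g \in unitmx -> two_form F ->
  dominant_energy g t0 (superenergy g F).
Proof.
move=> gu Fs.
have timelike u v : bil g u u < 0 -> bil g t0 u < 0 -> future_causal g t0 v ->
    0 <= bil g u (superenergy g F *m v).
  move=> uu tu fv; have uv := future_bil_lt0 gs lor tt0 uu tu fv.
  case: fv => [[v0 vv] tv]; pose a := Num.sqrt (- bil g u u).
  have a0 : 0 < a by rewrite sqrtr_gt0 oppr_gt0.
  have aa : bil g u u = - a ^+ 2 by rewrite sqr_sqrtr ?opprK // oppr_ge0 ltW.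
  rewrite -[u](scalerK (lt0r_neq0 a0)) scalerA mulrC -scalerA bilZl pmulr_rge0 //.
  apply: (superenergy_unit_timelike gs gu lor) => //.
    by rewrite !bilE aa; field; exact: lt0r_neq0.
  by rewrite bilZl pmulr_rlt0 // invr_gt0.
move=> u v [[u0 uu] tu] fv.
apply: (@nonneg_of_small_perturbation _ (bil g t0 (superenergy g F *m v))) => e e0.
rewrite -bilZl -bilDl; apply: timelike => //; rewrite !bilE ?(bilC gs u t0).
  have : e * bil g t0 u < 0 by rewrite pmulr_rlt0.
  have : e * (e * bil g t0 t0) < 0 by rewrite !pmulr_rlt0.
  lra.
by have : e * bil g t0 t0 < 0; [rewrite pmulr_rlt0 | lra].
Qed.

Variable T : 'M[R]_n.
Hypothesis dT : dominant_energy g t0 T.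

(** The expression is even in [u], so a past-pointing vector may be replaced by its opposite. *)
Lemma dominant_weak u : bil g u u <= 0 -> 0 <= bil g u (T *m u).
Proof.
move=> uu; have [->|u0] := eqVneq u 0; first by rewrite bil0l.
have := causal_bil_neq0 lor tt0 uu u0; rewrite neq_lt => /orP[tu|tu].
  by apply: dT; split.
rewrite -[bil _ _ _]opprK -bilNl -bilNr -mulmxN; apply: dT; split;
  by rewrite ?bilNr ?oppr_lt0 //; split; rewrite ?oppr_eq0 // bilNl bilNr opprK.
Qed.

(* If [T u] were spacelike, minus its component [p] orthogonal to [t0], tilted back to the null
   cone, would be a causal vector violating the dominant energy condition. *)
Lemma dominant_causal_flux u : bil g u u <= 0 -> bil g (T *m u) (T *m u) <= 0.
Proof.
have future w : future_causal g t0 w -> bil g (T *m w) (T *m w) <= 0.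
  move=> fw; rewrite leNgt; apply/negP; set q := T *m w => qq.
  pose p := q - (bil g t0 q / bil g t0 t0) *: t0.
  have t0n : bil g t0 t0 != 0 by rewrite lt_eqF.
  have tp : bil g t0 p = 0 by rewrite /p !bilE; field.
  have pq : bil g p q = bil g p p.
    rewrite {3}/p bilDr bilNr bilZr (bilC gs p t0) tp mulr0; by rewrite subr0.
  have qqE : bil g q q = bil g p p + bil g t0 q ^+ 2 / bil g t0 t0.
    by rewrite -pq /p !bilE; field.
  clearbody p.
  have i0 : (bil g t0 t0)^-1 < 0 by rewrite invr_lt0.
  have pp : 0 < bil g p p.
    have : bil g t0 q ^+ 2 / bil g t0 t0 <= 0 by rewrite mulr_ge0_le0 ?sqr_ge0 // ltW.
    lra.
  pose a := Num.sqrt (bil g p p / - bil g t0 t0).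
  have a0 : 0 < a by rewrite sqrtr_gt0 divr_gt0 // oppr_gt0.
  have aa : a ^+ 2 * bil g t0 t0 = - bil g p p.
    by rewrite sqr_sqrtr ?divr_ge0 ?oppr_ge0 1?ltW //; field; exact: t0n.
  have fv : future_causal g t0 (a *: t0 - p).
    split; last by rewrite !bilE tp oppr0 addr0 pmulr_rlt0.
    split.
      apply/eqP => /(congr1 (bil g t0)) /eqP; rewrite !bilE tp subr0 mulf_eq0 (negPf t0n).
      by rewrite orbF gt_eqF.
    rewrite !bilE tp (bilC gs p t0) tp; have := aa; rewrite expr2; lra.
  have := dT fv fw; rewrite -/q !bilE pq => h.
  (* A spacelike [q] gives |a g(t0,q)| < g(p,p), whereas the energy condition at a t0 - p gives a
     g(t0,q) >= g(p,p). *)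
  have : (a * bil g t0 q) ^+ 2 < bil g p p ^+ 2.
    rewrite exprMn; have := qq; rewrite qqE -(nmulr_llt0 _ tt0) mulrDl divfK // => h2.
    have a20 : 0 < a ^+ 2 by rewrite exprn_gt0.
    have : a ^+ 2 * (bil g p p * bil g t0 t0 + bil g t0 q ^+ 2) < 0 by rewrite pmulr_rlt0.
    rewrite mulrDr mulrCA aa; lra.
  rewrite ltr_sqr ?nnegrE ?ltW //; lra.
move=> uu; have [->|u0] := eqVneq u 0; first by rewrite mulmx0 bil0l.
have := causal_bil_neq0 lor tt0 uu u0; rewrite neq_lt => /orP[tu|tu].
  by apply: future; split.
rewrite -[bil _ _ _]opprK -bilNl -bilNr -mulmxN; apply: future; split;
  by rewrite ?bilNr ?oppr_lt0 //; split; rewrite ?oppr_eq0 // bilNl bilNr opprK.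
Qed.

End DominantEnergy.

(** * 2-forms of rank at most four *)

Section RankFour.
Variables (R : rcfType) (n : nat) (g : 'M[R]_n).
Hypothesis gs : g^T = g.
Hypothesis gu : g \in unitmx.
Implicit Types (t u v w x y z a b c d k : 'cV[R]_n) (F : 'M[R]_n).

Let gis : (invmx g)^T = invmx g.
Proof. by rewrite trmx_inv gs. Qed.

Definition mixed F : 'M[R]_n := invmx g *m F.

(* [det] of [F^a_b] on the image of [F], when [F] has rank at most four. *)
Definition quartic F : R := ((\tr (mixed F *m mixed F)) ^+ 2 / 2
  - \tr (mixed F *m mixed F *m (mixed F *m mixed F))) / 4.

Lemma gram4_lower a b c d :
  gram4 (invmx g) (g *m a) (g *m b) (g *m c) (g *m d) = gram4 g a b c d.
Proof.
have h u v : bil (invmx g) (g *m u) (g *m v) = bil g u v.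
  by rewrite /bil trmx_mul gs mulmxK // mulmxA.
by rewrite /gram4 /= !h.
Qed.

Lemma quartic_gram F a b c d :
  F = wedge (g *m a) (g *m b) + wedge (g *m c) (g *m d) -> quartic F = gram4 g a b c d.
Proof.
move=> /(wedge_quartic gis)[+ _]; rewrite /quartic /mixed => ->.
by rewrite gram4_lower; field.
Qed.

Lemma mixed_quartic F : two_form F -> (\rank F <= 4)%N ->
  let B := mixed F *m mixed F in
  \tr (B *m B) = (\tr B) ^+ 2 / 2 - 4 * quartic F /\
  B *m B *m B = (\tr B / 2) *: (B *m B) - quartic F *: B.
Proof.
move=> Fs rF B; have [x [y [z [w FE]]]] := two_form_rank_le4 Fs rF.
have [e1 e2] := wedge_quartic gis FE; split; first by rewrite /quartic -/B; field.
by rewrite e2; congr (_ - _ *: _); rewrite /quartic e1; field.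
Qed.

(** The last identity, a consequence of tr(B^2) = (tr B)^2 / 2 - 4 q, converts the trace
    inequalities of the theorem into the sign of q = [quartic F]. *)
Lemma superenergy_traces F : two_form F -> (\rank F <= 4)%N -> (4 < n)%N ->
  let T := superenergy g F in let B := mixed F *m mixed F in let k := (n - 4)%:R : R in
  [/\ T = (\tr B / 4)%:M - B, \tr T = k * (\tr B / 4) &
   k ^+ 2 * \tr (T *m T) = n%:R * \tr T ^+ 2 - 4 * k ^+ 2 * quartic F].
Proof.
move=> Fs rF n4 T B k; have [trBB _] := mixed_quartic Fs rF; rewrite -/B in trBB.
have TE : T = (\tr B / 4)%:M - B by rewrite /T superenergyE // mulrC.
have nk : n%:R = k + 4 :> R by rewrite /k natrB ?subrK // ltnW.
have trT : \tr T = k * (\tr B / 4).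
  by rewrite TE linearB /= mxtrace_scalar -[_ *+ n]mulr_natr nk; field.
split=> //; rewrite trT TE; clearbody B.
rewrite mulmxBl !mulmxBr !linearB /= !mul_scalar_mx !mul_mx_scalar !linearZ /= mxtrace_scalar trBB.
by rewrite -[_ *+ n]mulr_natr nk; field.
Qed.

(** The second factor is -B and the first is B^2 - (tr B / 2) B + q with q = [quartic F], so the
    product is minus the cubic relation of [mixed_quartic]. *)
Lemma superenergy_condition_b F : two_form F -> (\rank F <= 4)%N -> (4 < n)%N ->
  condition_b (superenergy g F).
Proof.
move=> Fs rF n4; have := superenergy_traces Fs rF n4; have := mixed_quartic Fs rF.
rewrite /condition_b; move: (superenergy g F) (mixed F *m mixed F) => T B /=.
set k := (n - 4)%:R => -[_ BBB] [TE trT trTT].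
have k0 : k != 0 by rewrite pnatr_eq0 subn_eq0 -ltnNge.
have nk : n%:R = k + 4 :> R by rewrite /k natrB ?subrK // ltnW.
have -> : T - (k^-1 * \tr T)%:M = - B.
  by rewrite trT mulKf // TE addrAC subrr add0r.
have trTT' : \tr (T *m T) = (n%:R * \tr T ^+ 2) / k ^+ 2 - 4 * quartic F.
  by apply: (mulfI (expf_neq0 2 k0)); rewrite trTT; field.
rewrite -addrA -raddfN -raddfD /= mulmxN; apply/eqP; rewrite oppr_eq0; apply/eqP.
set s := (_ + _ : R).
have -> : T *m T = ((\tr B / 4) ^+ 2)%:M - (\tr B / 2) *: B + B *m B.
  rewrite TE mulmxBl !mulmxBr !mul_scalar_mx !mul_mx_scalar scale_scalar_mx -expr2.
  have -> : \tr B / 2 = \tr B / 4 + \tr B / 4 by field.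
  by rewrite scalerDl opprB opprD !addrA (addrAC _ (B *m B)).
rewrite !mulmxDl mulNmx !mul_scalar_mx -scalemxAl BBB.
suff -> : s = quartic F - (\tr B / 4) ^+ 2.
  by rewrite scalerBl [X in X + _]addrA subrK addrA subrK subrr.
by rewrite /s trTT' trT nk; field; exact: k0.
Qed.

End RankFour.

(** * Decomposition of a 2-form into planes *)

Section Planes.
Variables (R : rcfType) (n : nat) (g : 'M[R]_n).
Hypothesis gs : g^T = g.
Hypothesis gu : g \in unitmx.
Hypothesis lor : forall t w : 'cV[R]_n,
  bil g t t < 0 -> bil g t w = 0 -> w != 0 -> 0 < bil g w w.
Implicit Types (t u v w x y z a b c d k : 'cV[R]_n) (F : 'M[R]_n).

Local Notation mixed := (mixed g).
Local Notation quartic := (quartic g).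

Lemma g_mixed F x : g *m (mixed F *m x) = F *m x.
Proof. by rewrite /mixed !mulmxA mulmxV // mul1mx. Qed.

(** One elimination step at [x] and [y]. The remainder annihilates both, so by antisymmetry its
    image is orthogonal to both. *)
Lemma two_form_splitting F x y : two_form F -> (\rank F <= 4)%N -> bil F x y != 0 ->
  exists p z w, let c := mixed F *m z in let d := mixed F *m w in
    [/\ F = wedge (g *m (mixed F *m x)) (g *m (mixed F *m (p *: y))) + wedge (g *m c) (g *m d),
        bil g x c = 0, bil g x d = 0, bil g y c = 0 & bil g y d = 0].
Proof.
move=> Fs rF p0; have [F's _ _ _] := two_form_subP Fs p0.
have [z [w [F'E F'x F'y]]] := two_form_rank_le4_sub Fs rF p0.
have orth e e' : two_form_sub F x y *m e = 0 ->
    bil g e (mixed (two_form_sub F x y) *m e') = 0.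
  move=> h; rewrite bil_mixed // two_form_bil // /bil -mulmxA h mulmx0 mxE oppr0.
  by [].
(* The remainder applied to [e] is [F] applied to [f e], which keeps all four vectors in the image
   of [mixed F]. *)
pose f e := e - (bil F x y)^-1 *: (bil F e y *: x - bil F e x *: y).
have sub e : mixed (two_form_sub F x y) *m e = mixed F *m f e.
  by rewrite /mixed -!mulmxA two_form_sub_vec.
exists (bil F x y)^-1, (f z), (f w); rewrite /= -!sub; split; try exact: orth.
rewrite !g_mixed -F'E -scalemxAr /wedge linearZ -scalemxAr -scalemxAl -scalerBr.
by rewrite -/(wedge _ _) addrC subrK.
Qed.

(** The expression is the Gram determinant of [b], [u], [v]. Let D be that of [u] and [v], with [u]
    nonzero: if D = 0 then [v] is a multiple of [u], and if D > 0 then D times the expression is the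
    square of a vector. *)
Lemma gram3_ge0 b u v :
  (forall p q r, p *: b + q *: u + r *: v != 0 ->
     0 < bil g (p *: b + q *: u + r *: v) (p *: b + q *: u + r *: v)) ->
  0 <= bil g b b * bil g u u * bil g v v + 2 * bil g b u * bil g u v * bil g b v
    - bil g b b * bil g u v ^+ 2 - bil g u u * bil g b v ^+ 2 - bil g v v * bil g b u ^+ 2.
Proof.
move=> pos; have pos0 p q r : 0 <= bil g (p *: b + q *: u + r *: v) (p *: b + q *: u + r *: v).
  by have [->|/pos/ltW//] := eqVneq (p *: b + q *: u + r *: v) 0; rewrite bil0l.
have bC := bilC gs.
have [->|u0] := eqVneq u 0; first by rewrite !bilE; lra.
have uu : 0 < bil g u u.
  by have := pos 0 1 0; rewrite !scale0r scale1r add0r addr0; apply.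
have D0 : 0 <= bil g u u * (bil g u u * bil g v v - bil g u v ^+ 2).
  have := pos0 0 (- bil g u v) (bil g u u).
  rewrite scale0r add0r !bilE (bC v u) => h; apply: le_trans h _.
  by rewrite le_eqVlt; apply/orP; left; apply/eqP; ring.
rewrite pmulr_rge0 // in D0; rewrite le_eqVlt in D0; case/orP: D0 => [/eqP D0|D0].
  have vE : v = (bil g u v / bil g u u) *: u.
    apply/eqP; rewrite -subr_eq0; apply: contraT => n0.
    have := pos 0 (- (bil g u v / bil g u u)) 1; rewrite scale0r scale1r add0r addrC scaleNr n0.
    move=> /(_ erefl); rewrite !bilE (bC v u).
    suff -> : bil g v v = bil g u v ^+ 2 / bil g u u.
      move=> h; exfalso; move: h; apply/negP; rewrite -leNgt le_eqVlt; apply/orP; left.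
      by apply/eqP; field; exact: lt0r_neq0.
    by apply: (mulfI (lt0r_neq0 uu)); rewrite mulrCA divff ?lt0r_neq0 // mulr1; lra.
  rewrite le_eqVlt; apply/orP; left; apply/eqP.
  by rewrite vE !bilE; field; exact: lt0r_neq0.
rewrite -(pmulr_rge0 _ D0).
(* The coefficients are cofactors, so this combination is orthogonal to [u] and [v]. *)
have := pos0 (bil g u u * bil g v v - bil g u v ^+ 2)
  (bil g u v * bil g b v - bil g b u * bil g v v) (bil g b u * bil g u v - bil g b v * bil g u u).
rewrite !bilE (bC u b) (bC v b) (bC v u) => h; apply: le_trans h _.
by rewrite le_eqVlt; apply/orP; left; apply/eqP; ring.
Qed.

Lemma gram4_orthogonal t b u v : bil g t b = 0 -> bil g t u = 0 -> bil g t v = 0 ->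
  gram4 g t b u v = bil g t t *
   (bil g b b * bil g u u * bil g v v + 2 * bil g b u * bil g u v * bil g b v
    - bil g b b * bil g u v ^+ 2 - bil g u u * bil g b v ^+ 2 - bil g v v * bil g b u ^+ 2).
Proof.
move=> tb tu tv; rewrite /gram4 /= !(bilC gs _ t) (bilC gs u b) (bilC gs v b) (bilC gs v u).
by rewrite tb tu tv; ring.
Qed.

Lemma quartic0 : quartic 0 = 0.
Proof. by rewrite /quartic /mixed !(mulmx0, mul0mx) mxtrace0; ring. Qed.

(* Contracting F with a vector of its image splits off a plane through that vector; the other
   plane is orthogonal to it. *)
Lemma two_form_nonnull_splitting F x : two_form F -> (\rank F <= 4)%N ->
  let t := mixed F *m x in bil g t t != 0 ->
  exists b z w, let u := mixed F *m z in let v := mixed F *m w in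
   [/\ F = wedge (g *m t) (g *m (mixed F *m b)) + wedge (g *m u) (g *m v),
       bil g t (mixed F *m b) = 0, bil g t u = 0 & bil g t v = 0].
Proof.
move=> Fs rF t tt; have p0 : bil F x t != 0.
  by rewrite two_form_bil // oppr_eq0 -(bil_mixed gu).
have [p [z [w [FE _ _ tu tv]]]] := two_form_splitting Fs rF p0.
exists (p *: t), z, w; split=> //.
by rewrite -scalemxAr bilZr bil_mixed // two_form_bil0 // mulr0.
Qed.

(** Splitting off the timelike vector leaves three vectors orthogonal to it, with nonnegative Gram
    determinant; [quartic F] is g(t,t) times that determinant. *)
Lemma quartic_le0_timelike F x : two_form F -> (\rank F <= 4)%N ->
  bil g (mixed F *m x) (mixed F *m x) < 0 -> quartic F <= 0.
Proof.
move=> Fs rF tt; have [b [z [w [FE tb tu tv]]]] := two_form_nonnull_splitting Fs rF (ltr0_neq0 tt).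
rewrite (quartic_gram gs gu FE) gram4_orthogonal //.
apply: mulr_le0_ge0; first exact: ltW.
by apply: gram3_ge0 => p q r; apply: (lor tt); rewrite !bilE tb tu tv !mulr0 !addr0.
Qed.

Lemma quartic_ge0_spacelike F : two_form F -> (\rank F <= 4)%N ->
  (forall x, mixed F *m x != 0 -> 0 < bil g (mixed F *m x) (mixed F *m x)) -> 0 <= quartic F.
Proof.
move=> Fs rF pos; have [->|/(two_form_bil_neq0 Fs)[y [x p0]]] := eqVneq F 0.
  by rewrite quartic0.
have tt : 0 < bil g (mixed F *m x) (mixed F *m x).
  apply: pos; apply: contra_neq p0 => h.
  by rewrite -(bil_mixed gu) h bil0r.
have [b [z [w [FE tb tu tv]]]] := two_form_nonnull_splitting Fs rF (lt0r_neq0 tt).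
rewrite (quartic_gram gs gu FE) gram4_orthogonal //.
apply: mulr_ge0; first exact: ltW.
by apply: gram3_ge0 => p q r; rewrite !scalemxAr -!mulmxDr; apply: pos.
Qed.

(** Semidefiniteness makes the null vector [k] orthogonal to the whole image. Since g(t,k) is
    nonzero, a splitting exists in which [k] is one of the four vectors, and their Gram determinant
    vanishes. *)
Lemma quartic_eq0_null F x t : two_form F -> (\rank F <= 4)%N -> bil g t t < 0 ->
  (forall y, 0 <= bil g (mixed F *m y) (mixed F *m y)) ->
  mixed F *m x != 0 -> bil g (mixed F *m x) (mixed F *m x) = 0 -> quartic F = 0.
Proof.
move=> Fs rF tt nonneg; set k := mixed F *m x => k0 kk.
have kperp y : bil g k (mixed F *m y) = 0.
  apply/eqP; apply: contraT => n0; set w := mixed F *m y in n0.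
  (* With this [s] the vector w + s k would have square -1. *)
  pose s := - (bil g w w + 1) / (2 * bil g k w).
  have := nonneg (y + s *: x); rewrite mulmxDr -scalemxAr -/k -/w !bilE kk (bilC gs w k).
  suff -> : s * bil g k w = - (bil g w w + 1) / 2 by lra.
  by rewrite /s; field.
have p0 : bil F x t != 0.
  rewrite two_form_bil // oppr_eq0 -(bil_mixed gu) -/k (causal_bil_neq0 lor) //.
  by rewrite kk.
have [p [z [w [FE _ _ _ _]]]] := two_form_splitting Fs rF p0.
by rewrite (quartic_gram gs gu FE) gram4_orthogonal ?kk ?mul0r // kperp.
Qed.

Lemma simple2_wedge u v : simple2 g (2 *: u) v = wedge (g *m u) (g *m v).
Proof.
rewrite /simple2 /wedge -scalemxAr linearZ -scalemxAl -scalemxAr -scalerBr scalerA.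
by rewrite mulVf ?pnatr_eq0 // scale1r.
Qed.

(** A positive [quartic F] excludes first timelike, then null vectors from the image, so any
    decomposition into two planes inside the image is spacelike. *)
Lemma two_spacelike_planes F t : two_form F -> (\rank F <= 4)%N -> bil g t t < 0 ->
  0 < quartic F ->
  exists u1 v1 u2 v2, [/\ spacelike_plane g u1 v1, spacelike_plane g u2 v2
    & F = simple2 g u1 v1 + simple2 g u2 v2].
Proof.
move=> Fs rF tt q0.
have nonneg y : 0 <= bil g (mixed F *m y) (mixed F *m y).
  by rewrite leNgt; apply: contraTN q0 => /(quartic_le0_timelike Fs rF); rewrite -leNgt.
have pos y : mixed F *m y != 0 -> 0 < bil g (mixed F *m y) (mixed F *m y).
  move=> y0; rewrite lt_def nonneg andbT; apply: contraTneq q0 => yy.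
  by rewrite (quartic_eq0_null Fs rF tt nonneg y0 yy) ltxx.
have [x [y [z [w FE]]]] := two_form_rank_le4 Fs rF.
exists (2 *: (mixed F *m x)), (mixed F *m y), (2 *: (mixed F *m z)), (mixed F *m w).
split; last by rewrite !simple2_wedge !g_mixed.
  by move=> a b; rewrite !scalemxAr -mulmxDr; apply: pos.
by move=> a b; rewrite !scalemxAr -mulmxDr; apply: pos.
Qed.

(** Without a timelike vector in the image [quartic F] would be nonnegative: zero if the image
    contains a nonzero null vector, a Gram determinant of a definite space otherwise. Once a
    timelike vector is split off, the other plane is orthogonal to it, hence spacelike. *)
Lemma spacelike_timelike_planes F t : two_form F -> (\rank F <= 4)%N -> bil g t t < 0 ->
  quartic F < 0 ->
  exists u1 v1 u2 v2, [/\ spacelike_plane g u1 v1, timelike_plane g u2 v2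
    & F = simple2 g u1 v1 + simple2 g u2 v2].
Proof.
move=> Fs rF tt q0.
have [x xx] : exists x, bil g (mixed F *m x) (mixed F *m x) < 0.
  apply: contrapT => /forallNP h.
  have nonneg y : 0 <= bil g (mixed F *m y) (mixed F *m y) by rewrite leNgt; apply/negP/h.
  suff : 0 <= quartic F by rewrite leNgt q0.
  apply: (quartic_ge0_spacelike Fs rF) => y y0.
  rewrite lt_def nonneg andbT; apply: contraTneq q0 => yy.
  by rewrite (quartic_eq0_null Fs rF tt nonneg y0 yy) ltxx.
have [b [z [w [FE tb tu tv]]]] := two_form_nonnull_splitting Fs rF (ltr0_neq0 xx).
exists (2 *: (mixed F *m z)), (mixed F *m w), (2 *: (mixed F *m x)), (mixed F *m b).
split; last by rewrite !simple2_wedge addrC.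
  by move=> a c; apply: (lor xx); rewrite !bilE tu tv !mulr0 addr0.
(* The coefficient 1/2 undoes the factor 2 that [simple2_wedge] puts on the first vector. *)
by exists 2^-1, 0; rewrite scale0r addr0 scalerA mulVf ?pnatr_eq0 // scale1r.
Qed.

End Planes.

(** * Recovering the 2-form from its superenergy tensor *)

Section Construction.
Variables (R : rcfType) (n : nat) (g : 'M[R]_n).
Hypothesis gs : g^T = g.
Hypothesis gu : g \in unitmx.
Hypothesis lor : forall t w : 'cV[R]_n,
  bil g t t < 0 -> bil g t w = 0 -> w != 0 -> 0 < bil g w w.
Implicit Types (t u v w x y z a b c d e k : 'cV[R]_n) (E F N T : 'M[R]_n).

Let bC := bilC gs.

Lemma rank_wedge a b : (\rank (wedge a b) <= 2)%N.
Proof.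
apply: leq_trans (mxrank_add _ _) _; rewrite mxrank_opp (@leq_add _ _ 1 1) //; exact: mulmx_max_rank.
Qed.

(** For A = a^b + c^d, orthogonality removes the cross terms and -A^2 is the bracketed sum X; the
    trace of [T] forces tr X = -4 m. Null and zero vectors are allowed, which serves the degenerate
    types. *)
Lemma superenergy_of_orthogonal (m k : R) T a b c d : n%:R = k + 4 -> \tr T = k * m ->
  bil g a b = 0 -> bil g a c = 0 -> bil g a d = 0 ->
  bil g b c = 0 -> bil g b d = 0 -> bil g c d = 0 ->
  T = m%:M + (bil g b b *: outer g a a + bil g a a *: outer g b b
           + (bil g d d *: outer g c c + bil g c c *: outer g d d)) ->
  exists F, [/\ two_form F, (\rank F <= 4)%N & T = superenergy g F].
Proof.
move=> nk trT ab ac ad bc bd cd; set X := (X in _%:M + X) => TE.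
pose F := wedge (g *m a) (g *m b) + wedge (g *m c) (g *m d).
have Fs : two_form F.
  have := (wedge_two_form (g *m a) (g *m b), wedge_two_form (g *m c) (g *m d)).
  by rewrite /two_form /F => -[w1 w2]; rewrite linearD /= w1 w2 -opprD.
have AE : invmx g *m F = outer g a b - outer g b a + (outer g c d - outer g d c).
  by rewrite /F /wedge !trmx_mul gs mulmxDr !mulmxBr -!mulmxA !(mulKmx gu) /outer -!mulmxA.
have AA : invmx g *m F *m (invmx g *m F) = - X.
  rewrite AE !(mulmxDl, mulmxDr, mulNmx, mulmxN) !outer_mul.
  rewrite (bC b a) (bC c a) (bC d a) (bC c b) (bC d b) (bC d c) ab ac ad bc bd cd.
  by rewrite !(scale0r, subr0, add0r, addr0, sub0r, oppr0, opprK) /X !opprD.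
exists F; split=> //.
  apply: leq_trans (mxrank_add _ _) _; exact: (leq_add (rank_wedge _ _) (rank_wedge _ _)).
rewrite superenergyE // AA linearN opprK TE /=; congr (_%:M + _).
have : \tr T = k * m by [].
rewrite TE linearD /= mxtrace_scalar -[_ *+ n]mulr_natr nk => h.
have -> : \tr X = - 4 * m by lra.
by field.
Qed.

(** The weights [p] and [q] are absorbed by scaling one vector of each plane by a square root; s =
    -1 serves a timelike [c]. *)
Lemma superenergy_of_orthonormal (m k p q s : R) T a b c d : n%:R = k + 4 -> \tr T = k * m ->
  bil g a b = 0 -> bil g a c = 0 -> bil g a d = 0 ->
  bil g b c = 0 -> bil g b d = 0 -> bil g c d = 0 ->
  bil g a a = 1 -> bil g b b = 1 -> bil g c c = s -> bil g d d = 1 -> 0 <= p -> 0 <= q ->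
  T = m%:M + (p *: (outer g a a + outer g b b) + q *: (outer g c c + s *: outer g d d)) ->
  exists F, [/\ two_form F, (\rank F <= 4)%N & T = superenergy g F].
Proof.
move=> nk trT ab ac ad bc bd cd aa bb cc dd p0 q0 TE.
apply: (@superenergy_of_orthogonal m k T (Num.sqrt p *: a) b (Num.sqrt q *: c) d) => //;
  rewrite ?bilZl ?bilZr ?ab ?ac ?ad ?bc ?bd ?cd ?mulr0 //.
rewrite aa bb cc dd TE !outerZl !outerZr !scalerA !mulr1 !mulrA -!expr2 !sqr_sqrtr //.
by rewrite !mul1r !scalerDr scalerA -!expr2 !sqr_sqrtr.
Qed.

Lemma lorentzian_projector2 E t : g_projector g E -> bil g (E *m t) (E *m t) < 0 -> \tr E = 2 ->
  exists e d, [/\ bil g e e = -1, bil g d d = 1, bil g e d = 0, E *m e = e /\ E *m d = d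
    & E = outer g d d - outer g e e].
Proof.
move=> pE tt trE; have [e Ee ee] := normalize_timelike gs pE.2 tt.
have [pE' sE' perp trE'] := projector_timelike gs lor pE Ee ee.
have {}trE' : \tr (E + outer g e e) = 1%:R by rewrite trE' trE; ring.
have [c [cc E'c]] := orthonormal_projector gs pE' sE' trE'.
move: E'c; rewrite big_ord1; set d := c ord0 => E'd.
have dd : bil g d d = 1 by rewrite cc.
have E'd' : (E + outer g e e) *m d = d by rewrite E'd outer_vec dd scale1r.
have ed : bil g e d = 0 by rewrite -E'd'.
exists e, d; split=> //; last by rewrite -E'd addrK.
by split=> //; move: E'd'; rewrite mulmxDl outer_vec ed scale0r addr0.
Qed.

(* The image of a nilpotent N is totally null, hence at most a line. *)
Lemma nilpotent_outer N t : bil g t t < 0 -> g_symmetric g N -> N *m N = 0 -> N != 0 ->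
  exists s k, [/\ k != 0, bil g k k = 0 & N = s *: outer g k k].
Proof.
move=> tt sN NN /nonzero_vec[x k0]; set k := N *m x in k0.
have NN0 y z : bil g (N *m y) (N *m z) = 0.
  by rewrite -(bil_sym gs) // mulmxA NN mul0mx bil0r.
have kk : bil g k k = 0 := NN0 x x.
have tk : bil g t k != 0 by apply: (causal_bil_neq0 lor) => //; rewrite kk.
have Nk y : N *m y = (bil g t (N *m y) / bil g t k) *: k.
  have [a Nya] := null_orthogonal_colinear gs lor tt kk (NN0 y y) (NN0 x y) k0.
  by rewrite Nya bilZr mulfK.
(* Here g(t, N y) = g(N t, y) and N t is itself a multiple of [k], whence the two divisions by
   g(t,k). *)
exists (bil g t (N *m t) / bil g t k / bil g t k), k; split=> //.
apply: matrix_vec_ext => y; rewrite -scalemxAl outer_vec scalerA.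
apply: (etrans (Nk y)); congr (_ *: _).
by rewrite (bil_sym gs) // {1}(Nk t) bilZl; field; exact: tk.
Qed.

(** Four linear equations in dimension at least five; this supplies the second vector of a null
    rotation. *)
Lemma orthogonal_nonzero a b c d : (4 < n)%N ->
  exists2 e, e != 0 & [/\ bil g a e = 0, bil g b e = 0, bil g c e = 0 & bil g d e = 0].
Proof.
move=> n4; pose K := kermx (g *m cols4 a b c d).
have K0 : K != 0.
  rewrite -mxrank_eq0 mxrank_ker subn_eq0 -ltnNge; apply: leq_ltn_trans n4.
  exact: rank_leq_col.
have [i Ki] : exists i, row i K != 0.
  apply: contrapT => /forallNP h; case/eqP: K0; apply/row_matrixP => i; rewrite row0.
  by have /negP := h i; rewrite negbK => /eqP.
have KC (j : 'I_4) : bil g (row i K)^T (nth 0 [:: a; b; c; d] j) = 0.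
  have : row i K *m (g *m cols4 a b c d) = 0 by rewrite -row_mul mulmx_ker row0.
  move=> /(congr1 (fun M : 'rV_4 => M 0 j)); rewrite mulmxA [RHS]mxE => <-.
  by rewrite /bil trmxK !mxE; apply: eq_bigr => l _; rewrite !mxE.
exists (row i K)^T; first by rewrite -trmx0 (inj_eq trmx_inj).
by rewrite ![bil g _ (row i K)^T]bC; split;
  [exact: (KC (@Ordinal 4 0 isT)) | exact: (KC (@Ordinal 4 1 isT))
  | exact: (KC (@Ordinal 4 2 isT)) | exact: (KC (@Ordinal 4 3 isT))].
Qed.

End Construction.

(** * Recovery of the 2-form from the energy condition and the cubic equation *)

Section Recovery.
Variables (R : rcfType) (n : nat) (g T : 'M[R]_n) (t0 : 'cV[R]_n) (k m c : R).
Hypothesis gs : g^T = g.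
Hypothesis gu : g \in unitmx.
Hypothesis lor : forall t w : 'cV[R]_n,
  bil g t t < 0 -> bil g t w = 0 -> w != 0 -> 0 < bil g w w.
Hypothesis tt0 : bil g t0 t0 < 0.
Hypothesis sT : g_symmetric g T.
Hypothesis dT : dominant_energy g t0 T.
Hypothesis n4 : (4 < n)%N.
Hypothesis nk : n%:R = k + 4.
Hypothesis trT : \tr T = k * m.
Hypothesis trTT : \tr (T *m T) = 4 * c + k * m ^+ 2.
Hypothesis cubic : (T *m T - c%:M) *m (T - m%:M) = 0.
Implicit Types (t u v w : 'cV[R]_n) (E N : 'M[R]_n).

Let weak := dominant_weak lor tt0 dT.
Let flux := dominant_causal_flux gs lor tt0 dT.
Local Notation T_is_superenergy := (exists F, [/\ two_form F, (\rank F <= 4)%N & T = superenergy g F]).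

Lemma rank_param_gt0 : 0 < k.
Proof. by move: n4; rewrite -(ltr_nat R) nk; lra. Qed.

(* Otherwise [T] would send the null vector [u + w], with [w] normalized, to a spacelike one. *)
Lemma dominant_compare u w (p q : R) : bil g u u < 0 -> w != 0 -> bil g u w = 0 ->
  bil g (T *m u) (T *m w) = 0 -> bil g (T *m u) (T *m u) = p * bil g u u ->
  bil g (T *m w) (T *m w) = q * bil g w w -> q <= p.
Proof.
move=> uu w0 uw TuTw Tuu Tww; have ww := lor uu uw w0.
pose a := Num.sqrt (- bil g u u / bil g w w).
have aa : a ^+ 2 * bil g w w = - bil g u u.
  by rewrite sqr_sqrtr ?divfK ?lt0r_neq0 // divr_ge0 ?oppr_ge0 // ltW.
have := @flux (u + a *: w); rewrite mulmxDr -scalemxAr !bilE.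
rewrite (bilC gs w u) (bilC gs (T *m w)) uw TuTw Tuu Tww !mulr0 !addr0 !add0r.
have -> : a * (a * bil g w w) = - bil g u u by rewrite -aa; ring.
have -> : a * (a * (q * bil g w w)) = - q * bil g u u by rewrite mulNr -mulrN -aa; ring.
by rewrite subrr => /(_ (lexx _)); rewrite -mulrDl nmulr_lle0 // subr_ge0.
Qed.

Lemma T_eigen_timelike u (p : R) : bil g u u < 0 -> T *m u = p *: u -> p <= 0.
Proof.
by move=> uu Tu; have := weak (ltW uu); rewrite Tu bilZr nmulr_lge0.
Qed.

Lemma projector_nonzero_vec E : \tr E != 0 -> exists w, E *m w != 0.
Proof. by move=> tr0; apply: nonzero_vec; apply: contra_neq tr0 => ->; rewrite mxtrace0. Qed.

Lemma cubic_comm : (T *m T - c%:M) *m T = m *: (T *m T - c%:M).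
Proof.
by apply/eqP; rewrite -subr_eq0 -mul_mx_scalar -mulmxBr cubic.
Qed.

Lemma g_sym_TT : g_symmetric g (T *m T - c%:M).
Proof. by apply: g_symD; [exact: g_symM | apply/g_symN/g_sym_scalar]. Qed.

(** By the cubic, [T] acts as [m] on the image of G = T^2 - c. So G^2 = (m^2 - c) G, and G / (m^2 -
    c) projects onto the eigenspace of [m]; [E] is the complementary projector. Its trace is 4
    because tr G = k (m^2 - c). *)
Lemma spectral_split : m ^+ 2 != c -> exists E, [/\ g_projector g E, T *m E = E *m T,
  T *m T *m E = c *: E, T *m (1%:M - E) = m *: (1%:M - E) & \tr E = 4].
Proof.
move=> mc; pose G := T *m T - c%:M; pose r := m ^+ 2 - c.
have r0 : r != 0 by rewrite subr_eq0.
have GT : G *m T = m *: G := cubic_comm.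
have TG : T *m G = m *: G by rewrite -GT /G mulmxBl mulmxBr scalar_mxC mulmxA.
have GG : G *m G = r *: G.
  by rewrite {1}/G mulmxBl -mulmxA TG -scalemxAr TG mul_scalar_mx scalerA -scalerBl.
pose E := 1%:M - r^-1 *: G.
have EC : 1%:M - E = r^-1 *: G by rewrite /E opprB addrC subrK.
have pC : g_projector g (r^-1 *: G).
  split; first exact/g_symZ/g_sym_TT.
  by rewrite -scalemxAl -scalemxAr GG scalerK.
exists E; split.
- exact: g_projector_compl.
- by rewrite /E mulmxBr mulmxBl mulmx1 mul1mx -scalemxAr -scalemxAl TG GT.
- apply/eqP; rewrite -subr_eq0 -mul_scalar_mx -mulmxBl -/G /E mulmxBr mulmx1 -scalemxAr GG.
  by rewrite scalerK // subrr.
- by rewrite EC -scalemxAr TG scalerA scalerA mulrC.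
- rewrite /E linearB linearZ /= mxtrace1 linearB /= mxtrace_scalar trTT -[c *+ n]mulr_natr nk.
  by apply: (mulfI r0); rewrite /r; field; exact: r0.
Qed.

(** On the image of [E] the square of [T] is l^2, so the eigenprojectors are (E + T E / l) / 2 and
    (E - T E / l) / 2. The complement carries the whole trace k m of [T], so tr(T E) = 0 and both
    halves have trace 2. *)
Lemma half_projectors E (l : R) : l != 0 -> l ^+ 2 = c -> g_projector g E -> T *m E = E *m T ->
  T *m T *m E = c *: E -> T *m (1%:M - E) = m *: (1%:M - E) -> \tr E = 4 ->
  exists E1 E2, [/\ g_projector g E1 /\ g_projector g E2, T *m E1 = l *: E1 /\ T *m E2 = - l *: E2,
    E1 *m E2 = 0, E = E1 + E2 & \tr E1 = 2 /\ \tr E2 = 2].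
Proof.
move=> l0 lc [sE EE] TE TTE TC trE.
have trTE : \tr (T *m E) = 0.
  have := congr1 mxtrace TC; rewrite mulmxBr mulmx1 linearB linearZ linearB /= mxtrace1 trE trT nk => h.
  lra.
pose P s := 2^-1 *: (E + s *: (T *m E)).
have TETE : T *m E *m (T *m E) = c *: E.
  by rewrite {2}TE mulmxA -(mulmxA T E E) EE -(mulmxA T E T) -TE mulmxA TTE.
have ETE : E *m (T *m E) = T *m E by rewrite mulmxA -TE -mulmxA EE.
have TEE : T *m E *m E = T *m E by rewrite -mulmxA EE.
have PP s s' : P s *m P s' = 4^-1 *: ((1 + s * s' * c) *: E + (s + s') *: (T *m E)).
  rewrite /P -scalemxAl -scalemxAr mulmxDl !mulmxDr -!scalemxAl -!scalemxAr EE ETE TEE TETE.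
  rewrite !scalerA; congr (_ *: _); first by field.
  rewrite !scalerDl scale1r -!addrA; congr (_ + _).
  by rewrite addrA addrC [in LHS](addrC (s' *: _)) ?mulrA.
have lcV : l^-1 * l^-1 * c = 1 by rewrite -lc; field; exact: l0.
have PE s s' p q : 4^-1 * (1 + s * s' * c) = 2^-1 * p -> 4^-1 * (s + s') = 2^-1 * q ->
    P s *m P s' = 2^-1 *: (p *: E + q *: (T *m E)).
  by move=> h1 h2; rewrite PP !scalerDr !scalerA h1 h2.
have pP s : s * s * c = 1 -> g_projector g (P s).
  move=> ss; split.
    by apply/g_symZ/(g_symD sE)/g_symZ/g_symM.
  by rewrite (PE s s 1 s) ?scale1r // ?ss; field.
have TP s : s * c = s^-1 -> s != 0 -> T *m P s = s^-1 *: P s.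
  move=> sc s0; rewrite /P -scalemxAr mulmxDr -scalemxAr mulmxA TTE (scalerA s c) sc.
  rewrite (scalerA s^-1) [s^-1 * _]mulrC -scalerA; congr (_ *: _).
  by rewrite scalerDr scalerA mulVf // scale1r addrC.
have trP s : \tr (P s) = 2.
  by rewrite /P linearZ linearD linearZ /= trTE trE; field.
have lV : l^-1 * c = l by rewrite -lc; field; exact: l0.
exists (P l^-1), (P (- l^-1)); split=> //.
- by split; apply: pP; rewrite ?mulrNN.
- by rewrite !TP ?invrK ?oppr_eq0 ?invr_eq0 // ?invrN ?invrK ?mulNr ?lV.
- rewrite (PE _ _ 0 0) ?scale0r ?addr0 ?scaler0 // ?subrr ?mulr0 //.
  by rewrite mulrN mulNr lcV subrr !mulr0.
- rewrite /P -scalerDr addrACA -scalerDl subrr scale0r addr0 -[E in RHS]scale1r -scalerDl.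
  by rewrite scalerA mulVf ?pnatr_eq0 // scale1r.
Qed.

Lemma recover_orthonormal (p q s : R) E1 E2 a b d e :
  E1 *m E2 = 0 -> g_projector g E1 ->
  E1 *m a = a -> E1 *m b = b -> E2 *m d = d -> E2 *m e = e ->
  bil g a b = 0 -> bil g d e = 0 -> bil g a a = 1 -> bil g b b = 1 ->
  bil g d d = s -> bil g e e = 1 -> 0 <= p -> 0 <= q ->
  T = m%:M + (p *: (outer g a a + outer g b b) + q *: (outer g d d + s *: outer g e e)) ->
  T_is_superenergy.
Proof.
move=> E12 pE1 Ea Eb Ed Ee ab de aa bb dd ee p0 q0 TE.
have orth x y : E1 *m x = x -> E2 *m y = y -> bil g x y = 0.
  by move=> <- <-; apply: bil_projector.
by apply: (@superenergy_of_orthonormal _ _ g gs gu m k p q s T a b d e) => //; apply: orth.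
Qed.

Lemma spacelike_im_sub E1 E : spacelike_im g E -> E *m E1 = E1 -> spacelike_im g E1.
Proof. by move=> sE EE1 w; rewrite -EE1 -mulmxA; apply: sE. Qed.

(** The timelike direction lies in the eigenspace of [m], so m <= 0 and [g] is positive definite on
    the image of [E]. With c = l^2 and l < -m, the tensor T - m = (l - m) E1 + (- m - l) E2 has
    nonnegative coefficients on two spacelike planes. *)
Lemma recover_timelike_simple : c < m ^+ 2 -> T_is_superenergy.
Proof.
move=> cm; have mc : m ^+ 2 != c by rewrite gt_eqF.
have [E [pE TE TTE TC trE]] := spectral_split mc.
have pC := g_projector_compl gs pE.
have TT u v : bil g (T *m u) (T *m v) = bil g u (T *m T *m v).
  by rewrite -(bil_sym gs) // mulmxA.
have trC : \tr (1%:M - E) = k by rewrite linearB /= mxtrace1 trE nk addrK.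
have k0 := rank_param_gt0.
have orth u w : bil g (E *m u) ((1%:M - E) *m w) = 0.
  exact: bil_projector pE (projector_compl_mul pE).
have TTC w : T *m T *m ((1%:M - E) *m w) = m ^+ 2 *: ((1%:M - E) *m w).
  by rewrite -mulmxA (mulmxA T _ w) TC -scalemxAl -scalemxAr mulmxA TC -scalemxAl scalerA.
have TTE' w : T *m T *m (E *m w) = c *: (E *m w) by rewrite mulmxA TTE -scalemxAl.
have [uu|uu] := timelike_projector gs tt0 pE.
  (* A timelike vector in the image of [E] would give m^2 <= c. *)
  have [|w w0] := @projector_nonzero_vec (1%:M - E); first by rewrite trC gt_eqF.
  have := @dominant_compare _ _ c (m ^+ 2) uu w0 (orth _ _).
  rewrite !TT TTC !TTE' !bilZr orth mulr0 => /(_ erefl erefl erefl).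
  by rewrite leNgt cm.
have m0 : m <= 0 by apply: (T_eigen_timelike uu); rewrite mulmxA TC -scalemxAl.
have sE : spacelike_im g E.
  by apply: (spacelike_im_perp lor uu) => w; rewrite (bilC gs) orth.
(* [T] preserves the definite image of [E] and multiplies squares there by [c], whence c >= 0. *)
have TEnn w : 0 <= c * bil g (E *m w) (E *m w).
  have -> : c * bil g (E *m w) (E *m w) = bil g (E *m (T *m w)) (E *m (T *m w)).
    by rewrite mulmxA -TE -mulmxA TT TTE' bilZr.
  by have [->|/sE/ltW//] := eqVneq (E *m (T *m w)) 0; rewrite bil0l.
have c0 : 0 <= c.
  have [|w w0] := @projector_nonzero_vec E; first by rewrite trE pnatr_eq0.
  by have := TEnn w; rewrite pmulr_lge0 // sE.
pose l := Num.sqrt c; have lc : l ^+ 2 = c by rewrite sqr_sqrtr.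
have l0 : 0 <= l by exact: sqrtr_ge0.
have lm : l < - m by rewrite -ltr_sqr ?nnegrE ?oppr_ge0 // sqrrN lc.
have TEE : T = T *m E + m *: (1%:M - E) by rewrite -TC -mulmxDr addrC subrK mulmx1.
(* The eigenprojectors divide by [l]. For l = 0, [T] maps the image of [E] to null vectors of a
   definite space, so T E = 0 and any orthonormal basis of that image serves. *)
have [l00|ln0] := eqVneq l 0.
  have {}c0 : c = 0 by rewrite -lc l00 expr0n.
  have TE0 : T *m E = 0.
    apply: matrix_vec_ext => w; rewrite mul0mx; apply/eqP; apply: contraT => n0.
    have h : T *m E *m w = E *m (T *m w) by rewrite TE mulmxA.
    by rewrite h in n0; have := sE _ n0; rewrite -h -mulmxA TT TTE' c0 scale0r bil0r ltxx.
  have [x [xx Ex]] := orthonormal_projector gs pE sE (trE : \tr E = 4%:R).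
  pose o i : 'I_4 := inord i.
  have oE i j : (i < 4)%N -> (j < 4)%N -> bil g (x (o i)) (x (o j)) = (i == j)%:R.
    by move=> hi hj; rewrite xx -val_eqE /= !inordK.
  apply: (@superenergy_of_orthonormal _ _ g gs gu m k (- m) (- m) 1 T
    (x (o 0)) (x (o 1)) (x (o 2)) (x (o 3)));
    rewrite ?oE ?oppr_ge0 //.
  rewrite TEE TE0 add0r scalerBr -scaleNr scalemx1 -scalerDr Ex scale1r.
  congr (_ + _ *: _); rewrite !big_ord_recl big_ord0 addr0 !addrA.
  by rewrite -!addrA; congr (_ + (_ + (_ + _)));
    congr (outer _ (x _) (x _)); apply/val_inj; rewrite /= inordK.
have [E1 [E2 [[pE1 pE2] [TE1 TE2] E12 EE [trE1 trE2]]]] := half_projectors ln0 lc pE TE TTE TC trE.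
have E21 : E2 *m E1 = 0.
  have := pE.2; rewrite EE mulmxDl !mulmxDr pE1.2 pE2.2 E12 addr0 => /(canRL (addKr _)).
  by rewrite addrA addNr add0r => /(canRL (addrK _)); rewrite subrr.
have sE1 : spacelike_im g E1.
  by apply: (spacelike_im_sub sE); rewrite EE mulmxDl pE1.2 E21 addr0.
have sE2 : spacelike_im g E2.
  by apply: (spacelike_im_sub sE); rewrite EE mulmxDl pE2.2 E12 add0r.
have [a [b [aa bb ab [Ea Eb] E1E]]] := orthonormal_projector2 gs pE1 sE1 trE1.
have [d [e [dd ee de [Ed Ee] E2E]]] := orthonormal_projector2 gs pE2 sE2 trE2.
apply: (@recover_orthonormal (l - m) (- m - l) 1 E1 E2 a b d e) => //.
- by rewrite subr_ge0 (le_trans m0).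
- by rewrite subr_ge0 ltW.
rewrite -E1E scale1r -E2E {1}TEE EE mulmxDr TE1 TE2 scalerBr scalemx1 [LHS]addrCA.
by congr (_ + _); apply/matrixP => i j; rewrite !mxE; ring.
Qed.

(** Now the image of [E] is Lorentzian. A timelike eigenvector has nonpositive eigenvalue, so the
    timelike direction falls to [E2], with eigenvalue -l. Since |m| < l, the weights l - m and l + m
    of the spacelike and the Lorentzian plane are positive. *)
Lemma recover_timelike_double : m ^+ 2 < c -> T_is_superenergy.
Proof.
move=> cm; have mc : m ^+ 2 != c by rewrite lt_eqF.
have [E [pE TE TTE TC trE]] := spectral_split mc.
have TT u v : bil g (T *m u) (T *m v) = bil g u (T *m T *m v).
  by rewrite -(bil_sym gs) // mulmxA.
have TTC w : T *m T *m ((1%:M - E) *m w) = m ^+ 2 *: ((1%:M - E) *m w).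
  by rewrite -mulmxA (mulmxA T _ w) TC -scalemxAl -scalemxAr mulmxA TC -scalemxAl scalerA.
have TTE' w : T *m T *m (E *m w) = c *: (E *m w) by rewrite mulmxA TTE -scalemxAl.
have orth u w : bil g ((1%:M - E) *m u) (E *m w) = 0.
  by rewrite (bilC gs); exact: bil_projector pE (projector_compl_mul pE).
have [uu|uu] := timelike_projector gs tt0 pE; last first.
  have [|w w0] := @projector_nonzero_vec E; first by rewrite trE pnatr_eq0.
  have := @dominant_compare _ _ (m ^+ 2) c uu w0 (orth _ _).
  rewrite !TT TTC !TTE' !bilZr orth mulr0 => /(_ erefl erefl erefl).
  by rewrite leNgt cm.
pose l := Num.sqrt c; have c0 : 0 < c by exact: le_lt_trans (sqr_ge0 _) cm.
have lc : l ^+ 2 = c by rewrite sqr_sqrtr // ltW.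
have l0 : 0 < l by rewrite sqrtr_gt0.
have /andP[ml lm] : - l < m < l.
  by have := cm; rewrite -lc => h; apply/andP; split; nra.
have [E1 [E2 [[pE1 pE2] [TE1 TE2] E12 EE [trE1 trE2]]]] :=
  half_projectors (lt0r_neq0 l0) lc pE TE TTE TC trE.
have uu2 : bil g (E2 *m t0) (E2 *m t0) < 0.
  have E1t : ~~ (bil g (E1 *m t0) (E1 *m t0) < 0).
    apply/negP => h; have := T_eigen_timelike h; rewrite mulmxA TE1 -scalemxAl => /(_ _ erefl).
    by rewrite leNgt l0.
  move: uu; rewrite EE mulmxDl bilDl !bilDr (bilC gs (E2 *m t0) (E1 *m t0)).
  rewrite (bil_projector gs t0 t0 pE1 E12) addr0 add0r; rewrite -leNgt in E1t; lra.
have sE1 : spacelike_im g E1.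
  by apply: (spacelike_im_perp lor uu2) => w; rewrite (bilC gs) (bil_projector gs _ _ pE1 E12).
have [a [b [aa bb ab [Ea Eb] E1E]]] := orthonormal_projector2 gs pE1 sE1 trE1.
have [e [d [ee dd ed [Ee Ed] E2E]]] := lorentzian_projector2 gs lor pE2 uu2 trE2.
apply: (@recover_orthonormal (l - m) (l + m) (-1) E1 E2 a b e d) => //.
- by rewrite subr_ge0 ltW.
- lra.
have -> : outer g e e + -1 *: outer g d d = - E2 by rewrite E2E opprB scaleN1r.
have TEE : T = T *m E + m *: (1%:M - E) by rewrite -TC -mulmxDr addrC subrK mulmx1.
rewrite -E1E {1}TEE EE mulmxDr TE1 TE2 scalerBr scalemx1 [LHS]addrCA.
by congr (_ + _); apply/matrixP => i j; rewrite !mxE; ring.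
Qed.

(** With S = T - m the cubic reads (T + m) S^2 = 0, so S^2 is 4 m^2 times the projector onto the
    eigenspace of -m, and tr(S^2) = 8 m^2 gives dimension two. On the complement only S^2 = 0 is
    obtained, so [T] may fail to be diagonalizable. *)
Lemma double_root_projector : c = m ^+ 2 -> m != 0 ->
  exists E, [/\ g_projector g E, T *m E = - m *: E, T *m E = E *m T,
    (T - m%:M) *m (T - m%:M) *m (1%:M - E) = 0 & \tr E = 2].
Proof.
move=> cm m0; pose S := T - m%:M; pose r := 4 * m ^+ 2; pose G := S *m S.
have r0 : r != 0 by rewrite mulf_neq0 ?pnatr_eq0 ?expf_neq0.
have sS : g_symmetric g S by apply: g_symD => //; apply/g_symN/g_sym_scalar.
have TS : T *m S = S *m T by rewrite /S mulmxBl mulmxBr scalar_mxC.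
have TG : T *m G = - m *: G.
  apply/eqP; rewrite scaleNr -subr_eq0 opprK -mul_scalar_mx -mulmxDl /G mulmxA.
  suff -> : (T + m%:M) *m S = T *m T - c%:M by rewrite cubic.
  by rewrite /S mulmxDl !mulmxBr scalar_mxC addrA subrK -scalar_mxM cm.
have GT : G *m T = - m *: G by rewrite -TG /G -mulmxA -TS mulmxA -TS mulmxA.
have SG : S *m G = (- 2 * m) *: G.
  by rewrite {1}/S mulmxBl TG mul_scalar_mx -scalerBl; congr (_ *: _); ring.
have GG : G *m G = r *: G.
  by rewrite {1}/G -mulmxA SG -scalemxAr SG scalerA; congr (_ *: _); rewrite /r; ring.
exists (r^-1 *: G); rewrite -/S -/G; split.
- split; first by apply/g_symZ/g_symM.
  by rewrite -scalemxAl -scalemxAr GG scalerK.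
- by rewrite -scalemxAr TG !scalerA mulrC.
- by rewrite -scalemxAr -scalemxAl TG GT.
- by rewrite mulmxBr mulmx1 -scalemxAr GG scalerK // subrr.
- rewrite linearZ /= /G {1}/S mulmxBl /S !mulmxBr mul_scalar_mx mul_mx_scalar !linearB /=.
  rewrite !linearZ /= mul_scalar_mx scale_scalar_mx trTT trT mxtrace_scalar -[_ *+ n]mulr_natr nk cm.
  by apply: (mulfI r0); rewrite mulrA divff // /r; ring.
Qed.

(** For m > 0 the image of [E] is Lorentzian. On the definite complement S^2 = 0 forces S = 0, so T
    = m - 2 m E comes from a single plane. *)
Lemma recover_timelike_degenerate : c = m ^+ 2 -> 0 < m -> T_is_superenergy.
Proof.
move=> cm m0; have [E [pE TE TEC SSC trE]] := double_root_projector cm (lt0r_neq0 m0).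
have pC := g_projector_compl gs pE; set S := T - m%:M in SSC.
have sS : g_symmetric g S by apply: g_symD => //; apply/g_symN/g_sym_scalar.
have uu : bil g (E *m t0) (E *m t0) < 0.
  have [//|] := timelike_projector gs tt0 pE; set u := _ *m t0 => uu.
  (* A timelike [u] in the complement would satisfy 0 = g(S u, S u) = g(T u, T u) - 2 m g(u, T u) +
     m^2 g(u,u), where the first two terms are nonpositive and the last is negative. *)
  have : S *m S *m u = 0 by rewrite /u mulmxA SSC mul0mx.
  move=> /(congr1 (bil g u)).
  rewrite -mulmxA (bil_sym gs _ _ sS) bil0r /S mulmxBl mul_scalar_mx !bilE (bilC gs (T *m u) u).
  have := flux (ltW uu); have := weak (ltW uu).
  have : m * (m * bil g u u) < 0 by rewrite !pmulr_rlt0.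
  by move=> h1 h2 h3; have : 0 <= m * bil g u (T *m u) by [exact: mulr_ge0 (ltW m0) h2]; lra.
have sC := spacelike_im_compl gs lor pE uu.
have SC : S *m (1%:M - E) = 0.
  apply: matrix_vec_ext => w; rewrite mul0mx; apply/eqP; apply: contraT => n0.
  have h : S *m (1%:M - E) *m w = (1%:M - E) *m (S *m w).
    rewrite mulmxA; congr (_ *m _); rewrite (mulmxBr S) (mulmxBl 1%:M) mulmx1 mul1mx.
    by congr (_ - _); rewrite /S mulmxBl mulmxBr TEC scalar_mxC.
  rewrite h in n0; have := sC _ n0.
  by rewrite -h -(mulmxA S) -(bil_sym gs _ _ sS) !(mulmxA S) SSC mul0mx bil0r ltxx.
have TEE : T = m%:M + (- 2 * m) *: E.
  have : S = S *m E + S *m (1%:M - E) by rewrite -mulmxDr addrC subrK mulmx1.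
  rewrite SC addr0 {2}/S mulmxBl TE mul_scalar_mx -scalerBl => SE.
  rewrite -[T](subrK m%:M) -/S SE addrC; congr (_ + _ *: _); ring.
have [e [d [ee dd ed _ E2E]]] := lorentzian_projector2 gs lor pE uu trE.
apply: (@superenergy_of_orthogonal _ _ g gs gu m k T 0 0 (Num.sqrt (2 * m) *: e) d) => //;
  rewrite ?bil0l ?bil0r // ?bilZl ?ed ?mulr0 //.
rewrite ?bilZl ?bilZr ee dd !outer0l !scaler0 !add0r outerZl outerZr !scalerA mul1r TEE E2E.
by rewrite mulrN1 mulrN -expr2 sqr_sqrtr ?mulr_ge0 // ?ltW // mulNr !scaleNr scalerBr opprB.
Qed.

(** A nonzero [N] equals q times the square of a null vector [x]. The plane of a multiple of [x] and
    a spacelike [e] orthogonal to [x], [u] and [v] contributes exactly this term, because g(x,x) = 0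
    kills the other one. *)
Lemma recover_null s N u v : bil g s s < 0 -> g_symmetric g N -> N *m N = 0 ->
  N *m u = 0 -> N *m v = 0 -> bil g s u = 0 -> bil g s v = 0 -> bil g u v = 0 ->
  T = m%:M + (N + (bil g v v *: outer g u u + bil g u u *: outer g v v)) -> T_is_superenergy.
Proof.
move=> ss sN NN Nu Nv su sv uv TE.
have [N0|N0] := eqVneq N 0.
  apply: (@superenergy_of_orthogonal _ _ g gs gu m k T 0 0 u v) => //; rewrite ?bil0l ?bil0r //.
  by rewrite !scale0r !addr0 TE N0.
have [q [x [x0 xx NE]]] := nilpotent_outer gs lor ss sN NN N0.
have q0 : q != 0 by apply: contra_neq N0 => q0; rewrite NE q0 scale0r.
have xperp y : N *m y = 0 -> bil g x y = 0.
  rewrite NE -scalemxAl outer_vec => /eqP; rewrite !scaler_eq0 (negPf q0) (negPf x0) orbF.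
  by move=> /eqP.
have xu := xperp _ Nu; have xv := xperp _ Nv.
have sx : bil g s x != 0 by apply: (causal_bil_neq0 lor) => //; rewrite xx.
have sn : bil g s s != 0 by rewrite lt_eqF.
(* [y] is the reflection of [x] in the hyperplane orthogonal to [s]: it is null, orthogonal to [u]
   and [v] but not to [x], and the energy condition at [y] becomes q g(x,y)^2 >= 0. *)
pose p := 2 * bil g s x / bil g s s; pose y := x - p *: s.
have yy : bil g y y = 0.
  by rewrite /y !bilE (bilC gs x s) xx /p; field; exact: sn.
have yu : bil g u y = 0 by rewrite /y !bilE (bilC gs u x) (bilC gs u s) xu su; ring.
have yv : bil g v y = 0 by rewrite /y !bilE (bilC gs v x) (bilC gs v s) xv sv; ring.
have xy : bil g x y = - 2 * bil g s x ^+ 2 / bil g s s.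
  by rewrite /y !bilE (bilC gs x s) xx /p; field; exact: sn.
have q1 : 0 < q.
  rewrite lt_def q0 -(@pmulr_lge0 _ (bil g x y ^+ 2)).
    have := @weak y; rewrite yy lexx TE !mulmxDl NE -!scalemxAl !outer_vec mul_scalar_mx yu yv.
    rewrite !scale0r !scaler0 !addr0 bilDr !bilZr yy mulr0 add0r (bilC gs y x) -expr2.
    by apply.
  by rewrite exprn_even_gt0 //= xy !mulf_neq0 ?invr_eq0 // ?oppr_eq0 ?pnatr_eq0 // expf_neq0.
have [e e0 [se xe ue ve]] := @orthogonal_nonzero R n g gs s x u v n4.
have ee := lor ss se e0.
apply: (@superenergy_of_orthogonal _ _ g gs gu m k T (Num.sqrt (q / bil g e e) *: x) e u v) => //;
  rewrite ?bilZl ?xe ?xu ?xv ?mulr0 // ?(bilC gs e) //.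
rewrite bilZr xx !mulr0 scale0r addr0 outerZl outerZr !scalerA -mulrA -expr2.
by rewrite sqr_sqrtr ?divr_ge0 ?ltW // mulrCA divff ?lt0r_neq0 // mulr1 -NE.
Qed.

(** For timelike [u] the vector v = T u is causal, and T^3 = 0 gives g(v, T v) = g(T v, T v) = 0. If
    [v] is timelike then T v = 0; if it is null and nonzero, T v is a multiple of [v], zero by
    nilpotency. Timelike vectors form an open set, so T^2 vanishes everywhere. *)
Lemma nilpotent_dominant : c = 0 -> m = 0 -> T *m T = 0.
Proof.
move=> c0 m0; have T3 : T *m T *m T = 0.
  by have := cubic; rewrite c0 m0 raddf0 !subr0.
have TT u v : bil g (T *m u) (T *m v) = bil g u (T *m T *m v).
  by rewrite -(bil_sym gs) // mulmxA.
have TTu u : bil g u u < 0 -> T *m T *m u = 0.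
  move=> uu; have := flux (ltW uu); set v := T *m u.
  have vTv : bil g v (T *m v) = 0 by rewrite TT mulmxA T3 mul0mx bil0r.
  have Tv0 : bil g (T *m v) (T *m v) = 0 by rewrite TT /v !mulmxA -(mulmxA (T *m T)) mulmxA T3 !mul0mx bil0r.
  rewrite -mulmxA -/v le_eqVlt => /orP[/eqP vv|vv]; last first.
    apply/eqP; apply: contraT => n0.
    by have := lor vv vTv n0; rewrite Tv0 ltxx.
  have [->|v0] := eqVneq v 0; first by rewrite mulmx0.
  have [a Ta] := null_orthogonal_colinear gs lor uu vv Tv0 vTv v0.
  have : T *m (T *m v) = 0 by rewrite /v !mulmxA T3 mul0mx.
  rewrite Ta -scalemxAr Ta scalerA => /eqP; rewrite scaler_eq0 (negPf v0) orbF mulf_eq0 orbb.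
  by move=> /eqP ->; rewrite scale0r.
apply: matrix_vec_ext => w; rewrite mul0mx.
(* [e] is small enough to make t0 + e w timelike: its square is at most e g(t0,t0). *)
pose X := 2 * `|bil g t0 w| + `|bil g w w|; pose e := - bil g t0 t0 / (X - bil g t0 t0).
have X0 : 0 <= X by rewrite addr_ge0 ?mulr_ge0.
have Xt : 0 < X - bil g t0 t0 by have := tt0; lra.
have e0 : 0 < e by rewrite divr_gt0 // oppr_gt0.
have eX : e * (X - bil g t0 t0) = - bil g t0 t0 by rewrite divfK // lt0r_neq0.
have e1 : e <= 1 by rewrite ler_pdivrMr // mul1r lerBrDr addrC subrr.
have : T *m T *m (t0 + e *: w) = 0.
  apply: TTu; rewrite !bilE (bilC gs w t0).
  have h1 : e * bil g t0 w <= e * `|bil g t0 w| by rewrite ler_pM2l // ler_norm.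
  have h2 : e * (e * bil g w w) <= e * `|bil g w w|.
    rewrite ler_pM2l //; apply: le_trans (ler_norm _) _; rewrite normrM (gtr0_norm e0).
    by rewrite ler_piMl.
  have h3 : e * bil g t0 t0 < 0 by rewrite pmulr_rlt0.
  have eX2 : e * X = 2 * (e * `|bil g t0 w|) + e * `|bil g w w| by rewrite /X; ring.
  move: eX; rewrite mulrBr eX2; lra.
rewrite mulmxDr TTu // add0r -scalemxAr => /eqP; rewrite scaler_eq0 gt_eqF //=.
by move=> /eqP.
Qed.

(** For m < 0 the eigenvalue -m on the image of [E] is positive, so that image is a spacelike plane
    and the timelike direction lies in the complement, where [T] is [m] plus a nilpotent of square
    zero. For m = 0, [T] itself is such a nilpotent. *)
Lemma recover_degenerate : c = m ^+ 2 -> m <= 0 -> T_is_superenergy.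
Proof.
move=> cm; rewrite le_eqVlt => /orP[/eqP m0|m0].
  apply: (@recover_null t0 T 0 0) => //; rewrite ?mulmx0 ?bil0r //.
    by apply: nilpotent_dominant; rewrite // cm m0 expr0n.
  by rewrite !scale0r m0 raddf0 add0r !addr0.
have [E [pE TE TEC SSC trE]] := double_root_projector cm (ltr0_neq0 m0).
set S := T - m%:M in SSC.
have sS : g_symmetric g S by apply: g_symD => //; apply/g_symN/g_sym_scalar.
have pC := g_projector_compl gs pE.
have uu : bil g ((1%:M - E) *m t0) ((1%:M - E) *m t0) < 0.
  have [h|//] := timelike_projector gs tt0 pE.
  have := T_eigen_timelike h; rewrite mulmxA TE -scalemxAl => /(_ _ erefl).
  by rewrite oppr_le0 leNgt m0.
have orth w : bil g ((1%:M - E) *m t0) (E *m w) = 0.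
  by rewrite (bilC gs); exact: bil_projector pE (projector_compl_mul pE).
have [a [b [aa bb ab [Ea Eb] EE]]] :=
  orthonormal_projector2 gs pE (spacelike_im_perp lor uu orth) trE.
have SCC : S *m (1%:M - E) = (1%:M - E) *m S.
  rewrite (mulmxBr S) (mulmxBl 1%:M) mulmx1 mul1mx.
  by congr (_ - _); rewrite /S mulmxBl mulmxBr TEC scalar_mxC.
have CE : (1%:M - E) *m E = 0 by rewrite mulmxBl mul1mx pE.2 subrr.
have NC w : E *m w = w -> S *m (1%:M - E) *m w = 0.
  by move=> <-; rewrite -!mulmxA (mulmxA (1%:M - E)) CE mul0mx mulmx0.
have m2 : 0 <= - 2 * m by lra.
apply: (@recover_null ((1%:M - E) *m t0) (S *m (1%:M - E)) (Num.sqrt (- 2 * m) *: a) b) => //.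
- by apply: g_symM => //; case: pC.
- by rewrite {1}SCC -mulmxA (mulmxA S) SSC mulmx0.
- by rewrite -scalemxAr NC // scaler0.
- exact: NC.
- by rewrite bilZr -Ea orth mulr0.
- by rewrite -Eb orth.
- by rewrite bilZl ab mulr0.
rewrite bilZl bilZr aa bb outerZl outerZr !scalerA mul1r mulr1 -expr2 sqr_sqrtr // -scalerDr -EE.
have -> : (- 2 * m) *: E = S *m E.
  by rewrite /S mulmxBl TE mul_scalar_mx -scalerBl; congr (_ *: _); ring.
by rewrite -mulmxDr subrK mulmx1 /S addrC subrK.
Qed.

Lemma dominant_condition_b_superenergy : T_is_superenergy.
Proof.
case: (ltgtP c (m ^+ 2)); [exact: recover_timelike_simple | exact: recover_timelike_double |].
move=> cm; have [m0|m0] := leP m 0; first exact: recover_degenerate.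
exact: recover_timelike_degenerate.
Qed.

End Recovery.

Theorem theorem6 (R : realType) (n : nat) (g T : 'M[R]_n) (t0 : 'cV[R]_n) :
  (4 < n)%N -> lorentz_metric g -> bil g t0 t0 < 0 -> g_symmetric g T ->
  ((exists F : 'M[R]_n, [/\ two_form F, (\rank F <= 4)%N & T = superenergy g F])
     <-> (dominant_energy g t0 T /\ condition_b T))
  /\
  (forall F : 'M[R]_n, two_form F -> (\rank F <= 4)%N -> T = superenergy g F ->
     ((n - 4)%:R ^+ 2 * \tr (T *m T) < n%:R * \tr T ^+ 2 ->
        exists u1 v1 u2 v2 : 'cV[R]_n,
          [/\ spacelike_plane g u1 v1, spacelike_plane g u2 v2
            & F = simple2 g u1 v1 + simple2 g u2 v2])
     /\
     ((n - 4)%:R ^+ 2 * \tr (T *m T) > n%:R * \tr T ^+ 2 ->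
        exists u1 v1 u2 v2 : 'cV[R]_n,
          [/\ spacelike_plane g u1 v1, timelike_plane g u2 v2
            & F = simple2 g u1 v1 + simple2 g u2 v2])).
Proof.
move=> n4 lg tt0 sT; have gs := lg.1; have gu := lorentz_unitmx lg.
have lor t w := @lorentz_timelike_perp _ _ g t w (ltn_trans (ltn0Sn 3) n4) lg.
have k0 : 0 < (n - 4)%:R :> R by rewrite ltr0n subn_gt0.
split.
  split=> [[F [Fs rF ->]]|[dT bT]].
    split; first exact: (superenergy_dominant gs lor tt0 gu Fs).
    exact: superenergy_condition_b.
  pose k := (n - 4)%:R : R; have kn : k != 0 by exact: lt0r_neq0.
  apply: (@dominant_condition_b_superenergy _ _ g T t0 k (k^-1 * \tr T)
    (4^-1 * \tr (T *m T) - (4 * k)^-1 * \tr T ^+ 2)) => //.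
  - by rewrite /k natrB ?subrK // ltnW.
  - by rewrite mulVKf.
  - by field; exact: kn.
  - have -> a b : T *m T - (a - b)%:M = T *m T - a%:M + b%:M.
      by rewrite raddfB /= opprB addrA addrAC.
    exact: bT.
(* The trace identity turns both inequalities into sign conditions on [quartic F]. *)
move=> F Fs rF TE; have [_ _ trT] := superenergy_traces gs Fs rF n4.
rewrite -TE in trT; rewrite trT.
have k2 : 0 < 4 * (n - 4)%:R ^+ 2 :> R by rewrite mulr_gt0 // exprn_gt0.
split=> h.
  apply: (two_spacelike_planes gs gu lor Fs rF tt0).
  by rewrite -(pmulr_rgt0 _ k2); lra.
apply: (spacelike_timelike_planes gs gu lor Fs rF tt0).
by rewrite -(pmulr_rlt0 _ k2); lra.
Qed.
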